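(* Let $A$ be a unitary operator in $\mathcal H$, let $x\in\mathcal H$, and let $C>0$. Then the following statements are equivalent. (i) The sequence $(A^kx)_{k\in\mathbb N}$ is a Bessel sequence with Bessel bound $C$. (ii) The sequence $(A^kx)_{k\in\mathbb Z}$ is a Bessel sequence with Bessel bound $C$. (iii) $\mu_x$ is Lipschitz continuous with respect to the arc length measure with constant $C$, i.e. $\mu_x(\Delta)\le C|\Delta|$ for every Borel set $\Delta\subset\mathbb T$. (iv) For any $y\in\mathcal H$ the measure $|\mu_{xy}|$ is Lipschitz continuous with respect to the set function $\Delta\mapsto\sqrt{\mu_y(\Delta)|\Delta|}$ with constant $C^{1/2}$, i.e. $|\mu_{xy}|(\Delta)\le C^{1/2}\sqrt{\mu_y(\Delta)\,|\Delta|}$ for every Borel set $\Delta\subset\mathbb T$. (v) $\|(A-\lambda)^{-1}x\|^2\le C\,\big|1-|\lambda|^2\big|^{-1}$ for all $\lambda\in\mathbb C$ with $|\lambda|\ne 1$.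
   Context: $\mathcal H$ is a complex Hilbert space with scalar product $\langle\cdot,\cdot\rangle$ (linear in the first argument). $\mathbb N$ includes zero. $\mathbb T$ is the unit circle in $\mathbb C$, and $|\Delta|$ denotes the arc length measure of a Borel set $\Delta\subset\mathbb T$, normalized so that $|\mathbb T|=1$. A family $(y_k)_{k\in K}$ ($K$ countable) in $\mathcal H$ is a Bessel sequence with Bessel bound $C>0$ if $\sum_{k\in K}|\langle y,y_k\rangle|^2\le C\|y\|^2$ for all $y\in\mathcal H$. $E$ denotes the spectral measure of the normal operator $A$ (defined on the Borel sets of $\mathbb C$; for unitary $A$ it is concentrated on $\mathbb T$). For $x,y\in\mathcal H$, $\mu_{xy}$ is the complex Borel measure $\mu_{xy}(\Delta)=\langle E(\Delta)x,y\rangle$, $|\mu_{xy}|$ is its total variation measure, and $\mu_x:=\mu_{xx}$, i.e. $\mu_x(\Delta)=\|E(\Delta)x\|^2$. *)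

(* Defs.v *)
From HB Require Import structures.
From mathcomp Require Import all_boot all_order all_algebra.
From mathcomp Require Import all_classical all_reals all_analysis.
From mathcomp Require Import complex.

Set Implicit Arguments.
Unset Strict Implicit.
Unset Printing Implicit Defensive.

Import Order.TTheory GRing.Theory Num.Theory.
Import numFieldNormedType.Exports.

Local Open Scope classical_set_scope.
Local Open Scope ring_scope.

(* Norms over R[i] take values in R[i]; this is the same norm as an element
   of R. *)
Definition rnorm (R : realType) (V : normedZmodType R[i]) (v : V) : R :=
  complex.Re `|v|.

Definition borelC (R : realType) := g_sigma_algebraType (@open R[i]^o).

Definition unit_circle (R : realType) : set (borelC R) :=
  [set z : R[i] | rnorm z = 1].

(* Image of the Lebesgue measure of [0, 1[ under t |-> exp (2 pi i t). *)
Definition arc_length (R : realType) (D : set (borelC R)) : \bar R :=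
  lebesgue_measure [set t : R | 0 <= t < 1 /\
    D (Complex (cos (2 * pi * t)) (sin (2 * pi * t)))].

Definition complex_variation (R : realType) (d : measure_display)
    (T : measurableType d) (m : set T -> R[i]) (D : set T) : \bar R :=
  ereal_sup [set (\sum_(0 <= n <oo) (rnorm (m (F n)))%:E)%E |
    F in [set F : nat -> set T | [/\ (forall n, measurable (F n)),
      trivIset [set: nat] F & \bigcup_n F n = D]]].

Definition op_inv (R : realType) (H : completeNormedModType R[i])
    (f : H -> H) : H -> H :=
  'pinv_(fun=> 0) [set: H] f.

Definition op_powz (R : realType) (H : completeNormedModType R[i])
    (f : H -> H) (k : int) : H -> H :=
  match k with
  | Posz n => iter n f
  | Negz n => iter n.+1 (op_inv f)
  end.

Definition resolvent (R : realType) (H : completeNormedModType R[i])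
    (f : H -> H) (l : R[i]) : H -> H :=
  op_inv (fun u => f u - l *: u).

(* In what follows, dot is the scalar product of H, linear in its first
   argument. *)

Definition unitary (R : realType) (H : completeNormedModType R[i])
    (dot : {dot H for Num.conj}) (A : {linear H -> H}) : Prop :=
  bijective A /\ forall u v, dot (A u) (A v) = dot u v.

Definition bessel (R : realType) (H : completeNormedModType R[i])
    (dot : {dot H for Num.conj}) (K : countType) (f : K -> H) (C : R) : Prop :=
  0 < C /\ forall y : H,
    (\esum_(k in [set: K]) (rnorm (dot y (f k)) ^+ 2)%:E
       <= (C * rnorm y ^+ 2)%:E)%E.

(* Projection-valued measures on the Borel sets of R[i]; the values of E
   outside the Borel sets are irrelevant. *)
Record projection_valued_measure (R : realType)
    (H : completeNormedModType R[i]) (dot : {dot H for Num.conj})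
    (E : set (borelC R) -> {linear H -> H}) : Prop := {
  pvm_idem : forall D, measurable D -> forall u, E D (E D u) = E D u ;
  pvm_selfadj : forall D, measurable D ->
    forall u v, dot (E D u) v = dot u (E D v) ;
  pvm_set0 : forall u, E set0 u = 0 ;
  pvm_setT : forall u, E setT u = u ;
  pvm_setI : forall D1 D2, measurable D1 -> measurable D2 ->
    forall u, E (D1 `&` D2) u = E D1 (E D2 u) ;
  pvm_bigcup : forall F : nat -> set (borelC R),
    (forall n, measurable (F n)) -> trivIset [set: nat] F ->
    forall u, series (fun n => E (F n) u) n @[n --> \oo]
      --> E (\bigcup_n F n) u }.

Definition mu_offdiag (R : realType) (H : completeNormedModType R[i])
    (dot : {dot H for Num.conj}) (E : set (borelC R) -> {linear H -> H})
    (x y : H) (D : set (borelC R)) : R[i] :=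
  dot (E D x) y.

Definition mu_diag (R : realType) (H : completeNormedModType R[i])
    (E : set (borelC R) -> {linear H -> H})
    (x : H) (D : set (borelC R)) : \bar R :=
  (rnorm (E D x) ^+ 2)%:E.

(* A is the integral of z dE(z), i.e. dot (A u) u is the integral of z with
   respect to mu_diag E u for every u (by polarization this gives
   dot (A u) v for all u and v). Integrability for every u says that the
   integral of z dE(z) is defined on the whole of H. *)
Definition spectral_measure_of (R : realType) (H : completeNormedModType R[i])
    (dot : {dot H for Num.conj}) (A : {linear H -> H})
    (E : set (borelC R) -> {linear H -> H}) : Prop :=
  projection_valued_measure dot E /\
  forall u : H,
    [/\ (mu_diag E u).-integrable [set: borelC R]
          (fun z => (complex.Re z)%:E),
        (mu_diag E u).-integrable [set: borelC R]
          (fun z => (complex.Im z)%:E) &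
        dot (A u) u = Complex
          (fine (\int[mu_diag E u]_z (complex.Re z)%:E)%E)
          (fine (\int[mu_diag E u]_z (complex.Im z)%:E)%E)].

(* Main.v *)
(* Each Bessel condition says that the synthesis operator is bounded:
   |sum_k c_k A^k x|^2 <= C sum_k |c_k|^2. Since A is isometric, the index set N
   may be replaced by Z, and a geometric choice of the c_k (a Neumann series)
   gives the resolvent bound.

   The passage to and from mu_x avoids Poisson integrals and functional calculus.
   Polarization of the form (A u, u) shows that E commutes with A and lives on the
   circle, and that |(A - w) v| is controlled by the distance from w to the points
   of D when v is in the range of E(D). Given the resolvent bound, average
   |(A - r w)^-1 E(I) x|^2 over N-th roots of unity w: discrete Parseval evaluates
   the average from below, while only the w close to the arc I contribute
   substantially. Letting N go to infinity, then r to 1, yields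
   mu_x(I) <= C |I|, and Borel sets follow by covering. Conversely, cut the
   circle into N small arcs; a polynomial p(A) acts on the range of each piece
   almost as the scalar p(w), so |p(A) x|^2 is close to
   sum_w |p(w)|^2 mu_x(piece) <= (C / N) sum_w |p(w)|^2 = C sum_k |c_k|^2,
   the last step being discrete Parseval again.

   Total variation is compared with mu_x by Cauchy-Schwarz, and taking y = x
   recovers the bound on mu_x. *)

Require Import Defs.
From HB Require Import structures.
From mathcomp Require Import all_boot all_order all_algebra.
From mathcomp Require Import all_classical all_reals all_analysis.
From mathcomp Require Import complex ring lra zify.

Set Implicit Arguments.
Unset Strict Implicit.
Unset Printing Implicit Defensive.

Import Order.TTheory GRing.Theory Num.Theory.
Import numFieldNormedType.Exports.

Local Open Scope classical_set_scope.
Local Open Scope ring_scope.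

(** * Real-valued norms and the scalar product *)

Section RealNorm.
Context {R : realType} {V : normedZmodType R[i]}.
Implicit Types u v : V.

Lemma rnormE u : `|u| = (rnorm u)%:C%C.
Proof.
rewrite /rnorm; have : 0 <= `|u| by [].
by case: `|u| => a b; rewrite lecE /= => /andP[/eqP -> _].
Qed.

Lemma rnorm_ge0 u : 0 <= rnorm u.
Proof. by have := normr_ge0 u; rewrite rnormE ler0c. Qed.

Lemma rnormD u v : rnorm (u + v) <= rnorm u + rnorm v.
Proof. by have := ler_normD u v; rewrite !rnormE -rmorphD lecR. Qed.

Lemma rnormN u : rnorm (- u) = rnorm u.
Proof. by rewrite /rnorm normrN. Qed.

Lemma rnormB u v : rnorm (u - v) <= rnorm u + rnorm v.
Proof. by rewrite -(rnormN v) rnormD. Qed.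

Lemma rnormC u v : rnorm (u - v) = rnorm (v - u).
Proof. by rewrite -rnormN opprB. Qed.

Lemma lerB_rnormD u v : rnorm u - rnorm v <= rnorm (u + v).
Proof. by rewrite lerBlDr -{1}(addrK v u) rnormB. Qed.

Lemma lerB_rnorm u v : rnorm u - rnorm v <= rnorm (u - v).
Proof. by rewrite -(rnormN v) lerB_rnormD. Qed.

Lemma rnorm0 : rnorm (0 : V) = 0.
Proof. by rewrite /rnorm normr0. Qed.

Lemma rnorm_eq0 u : rnorm u = 0 -> u = 0.
Proof. by move=> u0; apply/eqP; rewrite -normr_eq0 rnormE u0. Qed.

Lemma rnorm_sum I (r : seq I) (P : pred I) (F : I -> V) :
  rnorm (\sum_(i <- r | P i) F i) <= \sum_(i <- r | P i) rnorm (F i).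
Proof.
elim/big_rec2: _ => [|i y1 y2 _ ih]; first by rewrite rnorm0.
by rewrite (le_trans (rnormD _ _))// lerD2l.
Qed.

End RealNorm.

Lemma rnormZ (R : realType) (V : normedModType R[i]) (z : R[i]) (v : V) :
  rnorm (z *: v) = rnorm z * rnorm v.
Proof. by rewrite {1}/rnorm normrZ !rnormE -rmorphM. Qed.

Section Complex.
Context {R : realType}.
Implicit Types z w : R[i].

Lemma rnormM z w : rnorm (z * w) = rnorm z * rnorm w.
Proof. by rewrite {1}/rnorm normrM !rnormE -rmorphM. Qed.

Lemma rnorm1 : rnorm (1 : R[i]) = 1.
Proof. by rewrite /rnorm normr1. Qed.

Lemma rnormX z n : rnorm (z ^+ n) = rnorm z ^+ n.
Proof. by elim: n => [|n ih]; rewrite ?expr0 ?rnorm1// !exprS rnormM ih. Qed.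

Lemma sqr_rnorm z : rnorm z ^+ 2 = complex.Re z ^+ 2 + complex.Im z ^+ 2.
Proof. by case: z => a b; rewrite sqr_sqrtr// addr_ge0// sqr_ge0. Qed.

Lemma rnorm_real (r : R) : rnorm r%:C%C = `|r|.
Proof. by rewrite /rnorm/= expr0n/= addr0 sqrtr_sqr. Qed.

Lemma mulcJ z : z * conjc z = (rnorm z ^+ 2)%:C%C.
Proof.
rewrite sqr_rnorm; case: z => a b /=.
by apply/eqP; rewrite eq_complex /=; apply/andP; split; apply/eqP; ring.
Qed.

Lemma normr_Re z : `|complex.Re z| <= rnorm z.
Proof.
rewrite -(@ler_pXn2r _ 2)// ?nnegrE ?rnorm_ge0//.
by rewrite sqr_rnorm real_normK ?num_real// lerDl sqr_ge0.
Qed.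

Lemma Re_le_rnorm z : complex.Re z <= rnorm z.
Proof. exact: le_trans (ler_norm _) (normr_Re z). Qed.

Lemma rnorm_conjc z : rnorm (conjc z) = rnorm z.
Proof. by case: z => a b; rewrite /rnorm/= sqrrN. Qed.

Lemma ReD z w : complex.Re (z + w) = complex.Re z + complex.Re w.
Proof. by case: z; case: w. Qed.

Lemma ReN z : complex.Re (- z) = - complex.Re z.
Proof. by case: z. Qed.

Lemma Re_sum I (r : seq I) (P : pred I) (F : I -> R[i]) :
  complex.Re (\sum_(i <- r | P i) F i) = \sum_(i <- r | P i) complex.Re (F i).
Proof. by elim/big_rec2: _ => // i y1 y2 _ <-; rewrite ReD. Qed.

End Complex.

Section Dot.
Context {R : realType} {H : completeNormedModType R[i]}.
Context {dot : {dot H for Num.conj}}.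
Hypothesis dot_norm : forall u : H, dot u u = `|u| ^+ 2.
Implicit Types u v : H.

Lemma dotC u v : dot u v = conjc (dot v u).
Proof. by rewrite hermC expr0 mul1r. Qed.

Lemma dotZl z u v : dot (z *: u) v = z * dot u v.
Proof. exact: linearZl_LR. Qed.

Lemma dotZr z u v : dot u (z *: v) = conjc z * dot u v.
Proof. exact: linearZr_LR. Qed.

Lemma dotE u : dot u u = (rnorm u ^+ 2)%:C%C.
Proof. by rewrite dot_norm rnormE rmorphXn. Qed.

Lemma dotC_Re u v : complex.Re (dot u v) = complex.Re (dot v u).
Proof. by rewrite dotC; case: (dot v u). Qed.

Lemma sqr_rnormD u v :
  rnorm (u + v) ^+ 2 = rnorm u ^+ 2 + rnorm v ^+ 2 + 2 * complex.Re (dot u v).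
Proof.
have := dotE (u + v); rewrite linearDl linearDr/= linearDr/= !dotE.
move=> /(congr1 (@complex.Re _)); rewrite !ReD/= (dotC_Re v u) => <-.
ring.
Qed.

Lemma sqr_rnormD_orth u v : dot u v = 0 ->
  rnorm (u + v) ^+ 2 = rnorm u ^+ 2 + rnorm v ^+ 2.
Proof. by move=> uv; rewrite sqr_rnormD uv mulr0 addr0. Qed.

(** Expanding the squared norm of [|v|^2 u - d v] with [d = dot u v] gives
    [|v|^2 (|u|^2 |v|^2 - |d|^2)], which is nonnegative. *)
Lemma CauchySchwarz_dot u v : rnorm (dot u v) <= rnorm u * rnorm v.
Proof.
have [v0|v0] := eqVneq (rnorm v) 0.
  by rewrite (rnorm_eq0 v0) linear0r rnorm0 rnorm0 mulr0.
have vgt0 : 0 < rnorm v by rewrite lt_def v0 rnorm_ge0.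
set d := dot u v.
have : 0 <= rnorm ((rnorm v ^+ 2)%:C%C *: u - d *: v) ^+ 2 by rewrite sqr_ge0.
rewrite sqr_rnormD rnormN !rnormZ rnorm_real normrX [`|rnorm v|]ger0_norm ?rnorm_ge0//.
rewrite linearNr/= dotZl dotZr -/d ReN [conjc d * d]mulrC mulcJ.
rewrite [X in complex.Re X](_ : _ = (rnorm v ^+ 2 * rnorm d ^+ 2)%:C%C)/=; last first.
  by rewrite !rmorphM.
move=> h; rewrite -(@ler_pXn2r _ 2)// ?nnegrE ?mulr_ge0 ?rnorm_ge0//.
have v2 : 0 < rnorm v ^+ 2 by rewrite exprn_gt0.
rewrite -(ler_pM2l v2) exprMn -subr_ge0.
apply: le_trans h _; rewrite le_eqVlt; apply/orP; left; apply/eqP; ring.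
Qed.

Lemma sqr_rnorm_sum_orth (F : nat -> H) n :
  (forall i j, (i < j < n)%N -> dot (F i) (F j) = 0) ->
  rnorm (\sum_(i < n) F i) ^+ 2 = \sum_(i < n) rnorm (F i) ^+ 2.
Proof.
elim: n => [|n ih] Fo; first by rewrite !big_ord0 rnorm0 expr0n.
rewrite !big_ord_recr/= sqr_rnormD_orth ?ih//.
  by move=> i j /andP[ij jn]; rewrite Fo// ij ltnS ltnW.
by rewrite linear_sumlz big1 => [|i _]; rewrite /= ?Fo ?ltn_ord ?ltnSn.
Qed.

End Dot.

(** * Bessel sequences and synthesis operators *)

Lemma CauchySchwarz_sum (R : realFieldType) I (r : seq I) (a b : I -> R) :
  (\sum_(i <- r) a i * b i) ^+ 2 <=
  (\sum_(i <- r) a i ^+ 2) * (\sum_(i <- r) b i ^+ 2).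
Proof.
elim: r => [|i r ih]; first by rewrite !big_nil expr0n mul0r.
rewrite !big_cons; move: ih.
set S := \sum_(_ <- r) _; set A := \sum_(_ <- r) _; set B := \sum_(_ <- r) _.
move=> ih.
have A0 : 0 <= A by apply: sumr_ge0 => j _; exact: sqr_ge0.
have B0 : 0 <= B by apply: sumr_ge0 => j _; exact: sqr_ge0.
(* Only the cross term is left. Its square is at most [4 (a i * b i)^2 A B] by induction, and AM-GM
   bounds this by the square of the right-hand side. *)
suff : 2 * (a i * b i) * S <= a i ^+ 2 * B + b i ^+ 2 * A by nra.
have Y0 : 0 <= a i ^+ 2 * B + b i ^+ 2 * A.
  by rewrite addr_ge0// mulr_ge0// sqr_ge0.
rewrite (le_trans (ler_norm _))// -(@ler_pXn2r _ 2)// ?nnegrE//.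
rewrite real_normK ?num_real//.
have h : (a i * b i) ^+ 2 * S ^+ 2 <= (a i * b i) ^+ 2 * (A * B).
  by rewrite ler_wpM2l// sqr_ge0.
have := sqr_ge0 (a i ^+ 2 * B - b i ^+ 2 * A).
rewrite -subr_ge0 in h *; nra.
Qed.

Section Synthesis.
Context {R : realType} {H : completeNormedModType R[i]}.

(** Finite duplicate-free index lists avoid all convergence questions and let one definition serve
    both [nat] and [int]. *)
Definition synthesis_bound (K : eqType) (f : K -> H) (C : R) :=
  forall (s : seq K) (c : K -> R[i]), uniq s ->
    rnorm (\sum_(k <- s) c k *: f k) ^+ 2 <= C * \sum_(k <- s) rnorm (c k) ^+ 2.

Context {dot : {dot H for Num.conj}}.
Hypothesis dot_norm : forall u : H, dot u u = `|u| ^+ 2.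

(** Duality: [|v|^2] is the sum of [conjc (c k) * dot v (f k)]. Cauchy-Schwarz and the Bessel
    inequality at [v] itself bound its square, and one factor [|v|^2] cancels. *)
Lemma bessel_synthesis (K : countType) (f : K -> H) (C : R) :
  bessel dot f C -> synthesis_bound f C.
Proof.
move=> [C0 fC] s c us; set v := \sum_(k <- s) _.
have [->|v0] := eqVneq (rnorm v) 0.
  rewrite expr0n; apply: mulr_ge0; first exact: ltW.
  by apply: sumr_ge0 => *; exact: sqr_ge0.
have v2 : 0 < rnorm v ^+ 2 by rewrite exprn_gt0// lt_def v0 rnorm_ge0.
rewrite -(ler_pM2r v2) [leRHS]mulrAC.
have vf : \sum_(k <- s) rnorm (dot v (f k)) ^+ 2 <= C * rnorm v ^+ 2.
  rewrite -lee_fin (le_trans _ (fC v))// -sumEFin.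
  apply: esum_ge; exists [set` s]; first by split => //; exact: finite_seq.
  by rewrite -fsbig_seq.
apply: (@le_trans _ _ ((\sum_(k <- s) rnorm (c k) ^+ 2) *
    \sum_(k <- s) rnorm (dot v (f k)) ^+ 2)); last first.
  rewrite [leLHS]mulrC ler_wpM2r//; apply: sumr_ge0 => *; exact: sqr_ge0.
apply: le_trans (CauchySchwarz_sum _ _ _).
rewrite -expr2 ler_pXn2r// ?nnegrE ?sqr_ge0 ?sumr_ge0//; last first.
  by move=> *; rewrite mulr_ge0// rnorm_ge0.
have -> : rnorm v ^+ 2 = complex.Re (\sum_(k <- s) conjc (c k) * dot v (f k)).
  rewrite -[LHS]/(complex.Re (rnorm v ^+ 2)%:C%C) -(dotE dot_norm).
  rewrite {2}/v linear_sumr/=; congr complex.Re.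
  by apply: eq_bigr => k _; rewrite dotZr.
rewrite (le_trans (Re_le_rnorm _))// (le_trans (rnorm_sum _ _ _))//.
by apply: ler_sum => k _; rewrite rnormM rnorm_conjc.
Qed.

(** The coefficients [dot y (f k)] turn the partial Bessel sum [S] into [dot y v], so
    [S^2 <= |y|^2 |v|^2 <= |y|^2 C S], and [S] cancels. The infinite sum is a supremum of such
    [S]. *)
Lemma synthesis_bessel (K : countType) (f : K -> H) (C : R) :
  0 < C -> synthesis_bound f C -> bessel dot f C.
Proof.
move=> C0 fC; split=> // y; apply: ge_ereal_sup => _ [X [finX _] <-].
rewrite fsbig_finite//= sumEFin lee_fin.
set s := finmap.enum_fset (fset_set X); set S := \sum_(_ <- _) _.
have S0 : 0 <= S by apply: sumr_ge0 => *; exact: sqr_ge0.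
have := fC s (fun k => dot y (f k)) (finmap.fset_uniq _).
rewrite -/S; set v := \sum_(k <- _) _ => vS.
have SE : S = rnorm (dot y v).
  rewrite linear_sumr/= -[S]ger0_norm// -rnorm_real rmorph_sum/=.
  by congr rnorm; apply: eq_bigr => k _; rewrite dotZr mulrC mulcJ.
have [S00|Sn0] := eqVneq S 0; first by rewrite S00 mulr_ge0 ?sqr_ge0 ?ltW.
have Sgt0 : 0 < S by rewrite lt_def Sn0.
rewrite -(ler_pM2r Sgt0) [leRHS]mulrAC.
apply: (@le_trans _ _ ((rnorm y * rnorm v) ^+ 2)).
  rewrite -expr2 ler_pXn2r ?nnegrE ?mulr_ge0 ?rnorm_ge0//.
  by rewrite SE CauchySchwarz_dot.
by rewrite exprMn mulrC ler_wpM2r ?sqr_ge0.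
Qed.

Lemma synthesis_bound_ord (f : nat -> H) (C : R) n (c : nat -> R[i]) :
  synthesis_bound f C ->
  rnorm (\sum_(k < n) c k *: f k) ^+ 2 <= C * \sum_(k < n) rnorm (c k) ^+ 2.
Proof.
move=> /(_ (iota 0 n) c (iota_uniq _ _)).
rewrite -(big_mkord xpredT (fun k => rnorm (c k) ^+ 2)).
by rewrite -(big_mkord xpredT (fun k => c k *: f k)) /index_iota subn0.
Qed.

(** Initial segments suffice: a finite index set lies in one, and the missing coefficients are set
    to zero. *)
Lemma synthesis_bound_nat (f : nat -> H) (C : R) :
  (forall n (c : nat -> R[i]),
    rnorm (\sum_(k < n) c k *: f k) ^+ 2 <= C * \sum_(k < n) rnorm (c k) ^+ 2) ->
  synthesis_bound f C.
Proof.
move=> fC s c us; pose n := (\max_(k <- s) k).+1.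
pose c' k := if k \in s then c k else 0.
have {n} [n sn] : exists n, perm_eq s [seq k <- iota 0 n | k \in s].
  exists n.
  apply: uniq_perm => // [|k]; first by rewrite filter_uniq// iota_uniq.
  rewrite mem_filter mem_iota/= add0n; case ks : (k \in s) => //=.
  by rewrite /n ltnS (@leq_bigmax_seq _ _ xpredT id).
have := fC n c'.
rewrite -(big_mkord xpredT (fun k => rnorm (c' k) ^+ 2)).
rewrite -(big_mkord xpredT (fun k => c' k *: f k)) /index_iota subn0.
rewrite !(perm_big _ sn)/= !big_filter.
rewrite [in X in _ -> rnorm X ^+ 2 <= _]big_mkcond/=.
rewrite [in X in _ -> _ <= _ * X]big_mkcond/=.
congr (rnorm _ ^+ 2 <= _ * _); apply: eq_bigr => k _; rewrite /c'; case: ifP => //.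
  by rewrite scale0r.
by rewrite rnorm0 expr0n.
Qed.

End Synthesis.

(** * Isometries, inverses and two-sided orbits *)

Section Isometry.
Context {R : realType} {H : completeNormedModType R[i]}.
Variable U : {linear H -> H}.

Lemma iter_linZ n (z : R[i]) u : iter n U (z *: u) = z *: iter n U u.
Proof. by elim: n => //= n ->; rewrite linearZ. Qed.

Lemma iter_linB n u v : iter n U (u - v) = iter n U u - iter n U v.
Proof. by elim: n => //= n ->; rewrite linearB. Qed.

Lemma iter_sum n I (r : seq I) (P : pred I) (F : I -> H) :
  iter n U (\sum_(i <- r | P i) F i) = \sum_(i <- r | P i) iter n U (F i).
Proof. by elim: n => //= n ->; rewrite linear_sum. Qed.

Hypothesis U_iso : forall u, rnorm (U u) = rnorm u.

Lemma rnorm_iter n u : rnorm (iter n U u) = rnorm u.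
Proof. by elim: n => //= n <-; rewrite U_iso. Qed.

End Isometry.

Lemma op_invr (R : realType) (H : completeNormedModType R[i]) (f : H -> H) v :
  (exists u, f u = v) -> f (op_inv f v) = v.
Proof. by move=> [u uv]; rewrite /op_inv pinvK// inE; exists u. Qed.

Lemma op_invK (R : realType) (H : completeNormedModType R[i]) (f : H -> H) :
  bijective f -> cancel f (op_inv f) /\ cancel (op_inv f) f.
Proof.
move=> [g fK gK]; split=> u; last by apply: op_invr; exists (g u).
by rewrite /op_inv pinvKV ?in_setT// => a b _ _; exact: (can_inj fK).
Qed.

Section Unitary.
Context {R : realType} {H : completeNormedModType R[i]}.
Context {dot : {dot H for Num.conj}}.
Hypothesis dot_norm : forall u : H, dot u u = `|u| ^+ 2.
Variable A : {linear H -> H}.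
Hypothesis A_unitary : unitary dot A.

Lemma unitary_iso u : rnorm (A u) = rnorm u.
Proof.
have [_ /(_ u u)] := A_unitary; rewrite !(dotE dot_norm) => -[]/eqP.
by rewrite eqrXn2 ?rnorm_ge0// => /eqP.
Qed.

Lemma unitary_inv : exists2 B : {linear H -> H},
  (forall u, op_inv A u = B u) & unitary dot B.
Proof.
have [AB AD] := A_unitary; have [AK KA] := op_invK AB.
have lB : linear (op_inv A).
  by move=> a u v; apply: (bij_inj AB); rewrite linearP !KA.
pose m := GRing.isLinear.Build _ _ _ _ (op_inv A) lB.
pose B : {linear H -> H} := HB.pack (op_inv A) m.
exists B => //; split; first by exists A.
by move=> u v; rewrite -[in RHS](KA u) -[in RHS](KA v) AD.
Qed.

Lemma op_powz_shift (N : nat) (k : int) x : 0 <= N%:Z + k ->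
  iter N A (op_powz A k x) = iter (absz (N%:Z + k)) A x.
Proof.
have [AB AD] := A_unitary; have [AK KA] := op_invK AB.
case: k => k; first by move=> _; rewrite -iterD.
rewrite [op_powz _ _ _]/= -iterS NegzE -[(_ - _)%R]/(N%:Z - k.+1%:Z).
rewrite subr_ge0 lez_nat => kN; rewrite subzn// absz_nat.
rewrite -{1}(subnK kN) iterD; congr iter.
by elim: k.+1 => // n ih; rewrite iterSr [iter n.+1 _ _]/= KA.
Qed.

(** The isometric power [A^N], with [N] the largest absolute value of an index, moves a finite set
    of integer exponents into the naturals. *)
Lemma synthesis_int x (C : R) : synthesis_bound (fun k : nat => iter k A x) C ->
  synthesis_bound (fun k : int => op_powz A k x) C.
Proof.
move=> xC s c us; pose N := \max_(k <- s) `|k|%N.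
have sN k : k \in s -> 0 <= N%:Z + k.
  move=> ks; have : (`|k| <= N)%N by rewrite (@leq_bigmax_seq _ _ xpredT absz).
  by lia.
pose g k := (absz (N%:Z + k)); pose h (n : nat) := n%:Z - N%:Z.
have gK k : k \in s -> h (g k) = k.
  by move=> /sN k0; rewrite /h /g gez0_abs// addrC addKr.
have := xC (map g s) (c \o h); rewrite map_inj_in_uniq; last first.
  by move=> a b /gK {2}<- /gK {2}<- ->.
move=> /(_ us); rewrite !big_map => {}xC.
rewrite -(rnorm_iter unitary_iso N) iter_sum; move: xC.
rewrite [X in _ -> rnorm X ^+ 2 <= _]big_seq [X in rnorm X ^+ 2 <= _ -> _]big_seq.
rewrite [X in _ -> _ <= _ * X]big_seq [X in _ <= _ * X -> _]big_seq.
congr (rnorm _ ^+ 2 <= _ * _); apply: eq_bigr => k ks /=; rewrite gK//.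
by rewrite iter_linZ op_powz_shift ?sN.
Qed.

(** The isometric power [A^n] sends [B^k x] to [A^(n-k) x], so the bound for [A] applies with the
    coefficients in reverse order. *)
Lemma synthesis_inv x (C : R) (B : {linear H -> H}) :
  cancel B A ->
  synthesis_bound (fun k : nat => iter k A x) C ->
  synthesis_bound (fun k : nat => iter k B x) C.
Proof.
move=> KA xC; apply: synthesis_bound_nat => n c.
rewrite -(rnorm_iter unitary_iso n) iter_sum.
(* For [k < n] the exponent [n - k] runs over [1, ..., n]: the sum has length [n + 1], with
   coefficient 0 at exponent 0. *)
have := synthesis_bound_ord n.+1 (fun k => if k is 0%N then 0 else c (n - k)%N) xC.
rewrite !big_ord_recl scale0r add0r rnorm0 expr0n add0r.
rewrite (reindex_inj rev_ord_inj) [X in _ <= _ * X -> _](reindex_inj rev_ord_inj)/=.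
have E (k : 'I_n) : (n - bump 0 (n - k.+1))%N = k.
  by have := ltn_ord k; rewrite /bump/=; lia.
under eq_bigr => k _ do rewrite E.
under [X in _ <= _ * X -> _]eq_bigr => k _ do rewrite E.
move=> h; apply: le_trans h.
rewrite le_eqVlt; apply/orP; left; apply/eqP; congr (rnorm _ ^+ 2).
apply: eq_bigr => k _; rewrite iter_linZ; congr (_ *: _).
have kn := ltn_ord k.
transitivity (iter ((n - k.+1).+1 + k) A (iter k B x)); first by congr iter; lia.
rewrite iterD /bump /= ?add1n ?add0n; congr (A (iter _ _ _)).
by elim: (nat_of_ord k) => // m ih; rewrite iterSr [iter m.+1 _ _]/= KA.
Qed.

End Unitary.

(** * Neumann series and resolvents *)

Lemma subrACA (V : zmodType) (a b c d : V) :
  (a - b) - (c - d) = (a - c) - (b - d).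
Proof. by rewrite !opprD addrACA. Qed.

Lemma pos_complexE (R : realType) (e : R[i]) : 0 < e ->
  e = (complex.Re e)%:C%C /\ 0 < complex.Re e.
Proof. by case: e => a b; rewrite ltcE /= => /andP[/eqP -> ->]. Qed.

Lemma cauchy_rnorm (R : realType) (H : completeNormedModType R[i])
    (v : nat -> H) :
  (forall e : R, 0 < e -> exists N, forall n, (N <= n)%N ->
    rnorm (v N - v n) < e) ->
  exists y, forall e : R, 0 < e -> exists N, forall n, (N <= n)%N ->
    rnorm (y - v n) < e.
Proof.
move=> vC.
have : cvgn v.
  apply/cauchy_cvgP/cauchyP => e /pos_complexE[-> /vC[N vN]].
  exists (v N); exists N => // n /= Nn.
  by rewrite -ball_normE/= rnormE ltcR; exact: vN.
move=> /cvgrPdist_lt vl; exists (limn v) => e e0.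
have [|N _ vN] := vl e%:C%C; first by rewrite ltcR.
by exists N => n Nn; rewrite -ltcR -rnormE; exact: vN.
Qed.

Lemma small_expr (R : realType) (q K e : R) : 0 <= q < 1 -> 0 < e ->
  exists N, forall n, (N <= n)%N -> q ^+ n * K < e.
Proof.
move=> /andP[q0 q1] e0.
have : (fun n => q ^+ n * K) @ \oo --> 0 * K.
  by apply: cvgMl; apply: cvg_expr; rewrite ger0_norm.
rewrite mul0r => /cvgrPdist_lt/(_ e e0)[N _ h]; exists N => n /h.
by rewrite sub0r normrN; apply: le_lt_trans; exact: ler_norm.
Qed.

Section Neumann.
Context {R : realType} {H : completeNormedModType R[i]}.
Variable U : {linear H -> H}.
Hypothesis U_iso : forall u, rnorm (U u) = rnorm u.

Lemma iso_lower (l : R[i]) u : `|1 - rnorm l| * rnorm u <= rnorm (U u - l *: u).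
Proof.
have h1 := lerB_rnorm (U u) (l *: u).
have h2 := lerB_rnorm (l *: u) (U u).
rewrite rnormC in h2; rewrite U_iso rnormZ in h1 h2.
have [l1|l1] := leP (rnorm l) 1.
  by rewrite ger0_norm ?subr_ge0// mulrBl mul1r.
by rewrite ltr0_norm ?subr_lt0// opprB mulrBl mul1r.
Qed.

(** The solution is the limit of the partial sums of [m^k U^k x]. The synthesis bound with
    coefficients [m^k] controls each partial sum by [C] times a geometric sum in [|m|^2], and the
    bound passes to the limit. *)
Lemma neumann (m : R[i]) x : rnorm m < 1 ->
  exists2 y, y - m *: U y = x & forall C : R, 0 <= C ->
    synthesis_bound (fun k : nat => iter k U x) C ->
    rnorm y ^+ 2 <= C / (1 - rnorm m ^+ 2).
Proof.
move=> m1; have m0 := rnorm_ge0 m.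
have mi : 0 <= rnorm m < 1 by rewrite m0.
pose v n := \sum_(k < n) m ^+ k *: iter k U x.
have vE n : v n - m *: U (v n) = x - m ^+ n *: iter n U x.
  elim: n => [|n ih]; first by rewrite /v big_ord0 linear0 scaler0 expr0 scale1r !subrr.
  rewrite /v big_ord_recr/= -/(v n) [U (_ + _)]linearD [U (_ *: _)]linearZ/=
    scalerDr opprD addrACA ih.
  by rewrite scalerA -exprS addrA subrK.
(* Since [1 - m U] is bounded below, the small residuals [m^n U^n x] of the partial sums make them a
   Cauchy sequence. *)
have lowM u : (1 - rnorm m) * rnorm u <= rnorm (u - m *: U u).
  by apply: le_trans (lerB_rnorm _ _); rewrite rnormZ U_iso mulrBl mul1r.
have vlow N n : (N <= n)%N ->
    (1 - rnorm m) * rnorm (v N - v n) <= rnorm m ^+ N * (2 * rnorm x).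
  move=> Nn; apply: le_trans (lowM _) _.
  rewrite linearB/= scalerBr subrACA.
  rewrite !vE opprB addrC addrA subrK.
  rewrite (le_trans (rnormD _ _))// rnormN !rnormZ !rnormX !rnorm_iter//.
  rewrite mulrCA mulrA -mulrDl ler_wpM2r ?rnorm_ge0// mulrDl mul1r lerD2r.
  by rewrite ler_wiXn2l// ltW.
have m1' : 0 < 1 - rnorm m by rewrite subr_gt0.
have [y yv] : exists y, forall e : R, 0 < e -> exists N, forall n, (N <= n)%N ->
    rnorm (y - v n) < e.
  apply: cauchy_rnorm => e e0.
  have [|N sN] := small_expr (2 * rnorm x) mi (e := e * (1 - rnorm m)).
    by rewrite mulr_gt0.
  exists N => n Nn; rewrite -(ltr_pM2r m1') mulrC (le_lt_trans (vlow _ _ Nn))//.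
  exact: sN.
exists y.
  apply/eqP; rewrite -subr_eq0; apply/eqP/rnorm_eq0/le_anti.
  rewrite rnorm_ge0 andbT; apply/ler_addgt0Pl => e e0; rewrite addr0.
  have e30 : 0 < e / 3 by rewrite divr_gt0.
  have [N1 h1] := yv _ e30; have [N2 h2] := small_expr (rnorm x) mi e30.
  pose n := maxn N1 N2.
  have {h1} := h1 n (leq_maxl _ _); have {h2} := h2 n (leq_maxr _ _).
  have -> : y - m *: U y - x =
      (y - v n) - m *: U (y - v n) - m ^+ n *: iter n U x.
    have xE : x = v n - m *: U (v n) + m ^+ n *: iter n U x by rewrite vE subrK.
    rewrite [X in _ - X = _]xE opprD addrA; congr (_ - _).
    by rewrite [U (_ - _)]linearB/= scalerBr subrACA.
  move=> h2 h1; apply: le_trans (rnormB _ _) _.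
  have := rnormB (y - v n) (m *: U (y - v n)).
  rewrite !rnormZ U_iso rnormX rnorm_iter//.
  have : rnorm m * rnorm (y - v n) <= rnorm (y - v n).
    by rewrite ler_piMl ?rnorm_ge0// ltW.
  by lra.
move=> C C0 xC.
have q1 : 0 < 1 - rnorm m ^+ 2 by rewrite subr_gt0 expr_lt1.
have vC n : rnorm (v n) ^+ 2 <= C / (1 - rnorm m ^+ 2).
  apply: le_trans (synthesis_bound_ord n _ xC) _.
  rewrite ler_wpM2l// -[_^-1]mul1r ler_pdivlMr// mulrC.
  under eq_bigr => k _ do rewrite rnormX exprAC.
  by rewrite -opprB mulNr -subrX1 opprB gerBl exprn_ge0 ?sqr_ge0.
have K0 : 0 <= C / (1 - rnorm m ^+ 2) by rewrite divr_ge0// ltW.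
rewrite -(@sqr_sqrtr _ (C / _))// ler_pXn2r ?nnegrE ?rnorm_ge0 ?sqrtr_ge0//.
apply/ler_addgt0Pl => e /yv[N /(_ N (leqnn _))] yN.
rewrite -(subrK (v N) y) (le_trans (rnormD _ _))// lerD ?(ltW yN)//.
by rewrite -(@ler_pXn2r _ 2) ?nnegrE ?rnorm_ge0 ?sqrtr_ge0// sqr_sqrtr.
Qed.

End Neumann.

Section Resolvent.
Context {R : realType} {H : completeNormedModType R[i]}.
Context {dot : {dot H for Num.conj}}.
Hypothesis dot_norm : forall u : H, dot u u = `|u| ^+ 2.
Variable A : {linear H -> H}.
Hypothesis A_unitary : unitary dot A.

Let A_iso := unitary_iso dot_norm A_unitary.

Lemma resolvent_solution (l : R[i]) x : rnorm l <> 1 ->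
  exists2 y, A y - l *: y = x & forall C : R, 0 <= C ->
    synthesis_bound (fun k : nat => iter k A x) C ->
    rnorm y ^+ 2 <= C * `|1 - rnorm l ^+ 2|^-1.
Proof.
move=> /eqP l1.
have [AB _] := A_unitary; have [AK KA] := op_invK AB.
have [B BE B_unitary] := unitary_inv A_unitary.
have KB : cancel B A by move=> u; rewrite -BE KA.
have [ll|ll|/eqP] := ltgtP (rnorm l) 1; last by rewrite (negbTE l1).
- have [y yE yC] := neumann (unitary_iso dot_norm B_unitary) x ll.
  (* Inside the circle [A - l = (1 - l B) A], so the Neumann solution for [B], the inverse of [A],
     is pulled back by [B]. *)
  exists (B y).
    by rewrite KB.
  move=> C C0 xC; rewrite (unitary_iso dot_norm B_unitary).
  rewrite ger0_norm; last by rewrite subr_ge0 ltW// expr_lt1// rnorm_ge0.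
  by apply: yC => //; exact: (synthesis_inv dot_norm A_unitary KB).
- have lV : rnorm l^-1 = (rnorm l)^-1.
    have ln0 : l != 0.
      by apply: contraTneq ll => ->; rewrite rnorm0 -leNgt ler01.
    apply: (@mulfI _ (rnorm l)); first by rewrite gt_eqF// (lt_trans _ ll).
    by rewrite -rnormM !divff ?rnorm1// gt_eqF// (lt_trans _ ll).
  have l0 : 0 < rnorm l by rewrite (lt_trans _ ll).
  have ln0 : l != 0 by apply: contraTneq l0 => ->; rewrite rnorm0 ltxx.
  have [|y yE yC] := neumann (m := l^-1) A_iso x.
    by rewrite lV invf_lt1.
  (* Outside the circle [A - l = - l (1 - l^-1 A)]. *)
  exists (- l^-1 *: y).
    by rewrite linearZ/= scalerA mulrN divff// !scaleNr scale1r opprK addrC.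
  move=> C C0 /(yC _ C0); rewrite scaleNr rnormN rnormZ lV exprMn => h.
  have l2 : 1 < rnorm l ^+ 2 by rewrite expr_gt1// ltW.
  rewrite ltr0_norm ?subr_lt0// opprB.
  have -> : C / (rnorm l ^+ 2 - 1) = (rnorm l)^-1 ^+ 2 * (C / (1 - (rnorm l)^-1 ^+ 2)).
    move: l0 l2; generalize (rnorm l) => a a0 a1.
    by field; rewrite !gt_eqF ?subr_gt0.
  by rewrite ler_wpM2l ?sqr_ge0// -lV.
Qed.

(** [op_inv] returns a preimage as soon as one exists, so its default value 0 is never taken when
    [A - l] is onto. *)
Lemma resolventK (l : R[i]) x : rnorm l <> 1 ->
  A (resolvent A l x) - l *: resolvent A l x = x.
Proof.
move=> l1; have [y yE _] := resolvent_solution x l1.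
by apply: (op_invr (f := fun u => A u - l *: u)); exists y.
Qed.

Lemma unitary_sub_scale_inj (l : R[i]) u v : rnorm l <> 1 ->
  A u - l *: u = A v - l *: v -> u = v.
Proof.
move=> /eqP l1 uv; apply/eqP; rewrite -subr_eq0; apply/eqP/rnorm_eq0.
have : `|1 - rnorm l| * rnorm (u - v) <= 0.
  apply: le_trans (iso_lower A_iso _ _) _.
  by rewrite linearB/= scalerBr subrACA uv subrr rnorm0.
rewrite pmulr_rle0 ?normr_gt0 ?subr_eq0 1?eq_sym// => h.
by apply: le_anti; rewrite h rnorm_ge0.
Qed.

Lemma resolvent_bound (l : R[i]) x (C : R) : 0 <= C -> rnorm l <> 1 ->
  synthesis_bound (fun k : nat => iter k A x) C ->
  rnorm (resolvent A l x) ^+ 2 <= C * `|1 - rnorm l ^+ 2|^-1.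
Proof.
move=> C0 l1 xC; have [y yE yC] := resolvent_solution x l1.
have -> : resolvent A l x = y.
  by apply: (unitary_sub_scale_inj l1); rewrite resolventK.
exact: yC.
Qed.

End Resolvent.

(** * The circle and the discrete Fourier transform *)

Section Circle.
Context {R : realType}.
Implicit Types s t d : R.

(** Period 1, matching the parametrization inside [arc_length]. *)
Definition cis t : R[i] := Complex (cos (2 * pi * t)) (sin (2 * pi * t)).

Lemma cisD s t : cis (s + t) = cis s * cis t.
Proof.
rewrite /cis mulrDr cosD sinD; apply/eqP; rewrite eq_complex /=.
by apply/andP; split; apply/eqP; ring.
Qed.

Lemma cis0 : cis 0 = 1.
Proof. by rewrite /cis mulr0 cos0 sin0. Qed.

Lemma cis_muln n t : cis (n%:R * t) = cis t ^+ n.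
Proof.
elim: n => [|n ih]; first by rewrite mul0r cis0.
by rewrite exprS -ih -cisD mulrS mulrDl mul1r.
Qed.

Lemma cis1 : cis 1 = 1.
Proof. by rewrite /cis mulr1 mulr_natl cos2pi sin2pi. Qed.

Lemma cis_nat n : cis n%:R = 1.
Proof. by rewrite -[n%:R]mulr1 cis_muln cis1 expr1n. Qed.

Lemma cisN t : cis (- t) = conjc (cis t).
Proof. by rewrite /cis mulrN cosN sinN. Qed.

Lemma sqr_rnorm_cisB s t :
  rnorm (cis s - cis t) ^+ 2 = 2 - 2 * cos (2 * pi * (s - t)).
Proof.
rewrite sqr_rnorm /cis/= mulrBr cosB.
have := cos2Dsin2 (2 * pi * s); have := cos2Dsin2 (2 * pi * t).
nra.
Qed.

Lemma rnorm_cis t : rnorm (cis t) = 1.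
Proof. by rewrite /rnorm/cis/= cos2Dsin2 sqrtr1. Qed.

Lemma cos_lt1 d : 0 < d <= 1 / 2 -> cos (2 * pi * d) < 1.
Proof.
have p0 := @pi_gt0 R.
move=> /andP[d0 d1]; have h0 : 0 < 2 * pi * d by rewrite !mulr_gt0.
have h1 : 2 * pi * d <= pi by nra.
by rewrite -[X in _ < X]cos0 ltr_cos ?in_itv/= ?lexx ?pi_ge0
  ?h1 ?h0 ?(ltW h0) ?andbT ?(ltW p0).
Qed.

Lemma cos_le d t : 0 < d <= 1 / 2 -> d <= t <= 1 - d ->
  cos (2 * pi * t) <= cos (2 * pi * d).
Proof.
have p0 := @pi_gt0 R.
move=> /andP[d0 d1] /andP[dt td].
have main u : d <= u <= 1 / 2 -> cos (2 * pi * u) <= cos (2 * pi * d).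
  move=> /andP[du u1].
  have h0 : 0 <= 2 * pi * d by rewrite !mulr_ge0// ltW.
  have h1 : 2 * pi * d <= 2 * pi * u by nra.
  have h2 : 2 * pi * u <= pi by nra.
  rewrite leNgt ltr_cos ?in_itv/= -?leNgt//.
    by rewrite (le_trans h0 h1) h2.
  by rewrite h0 (le_trans h1 h2).
have [t1|t1] := leP t (1 / 2); first by rewrite main// dt.
(* The second half of the period is reflected onto the first, where cosine is decreasing. *)
have -> : cos (2 * pi * t) = cos (2 * pi * (1 - t)).
  by rewrite -(cosN (2 * pi * (1 - t))) -[RHS]cosD2pi; congr cos; ring.
by apply: main; apply/andP; split; lra.
Qed.

Lemma cis_inj s t : 0 <= s < 1 -> 0 <= t < 1 -> cis s = cis t -> s = t.
Proof.
wlog : s t / s < t => [H|st] s1 t1 st'.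
  by have [st|ts|//] := ltgtP s t; [exact: H|apply/esym/H].
have := sqr_rnorm_cisB t s; rewrite st' subrr rnorm0 expr0n/=.
(* [d] is the circular distance of the two parameters; it is positive, so the chord would have
   positive length. *)
pose d : R := Num.min (t - s) (1 - (t - s)).
have dE : 0 < d <= 1 / 2 /\ d <= t - s <= 1 - d.
  move: s1 t1 {st'} => /andP[? ?] /andP[? ?].
  by rewrite /d; case: (leP (t - s) (1 - (t - s))) => ?; split; apply/andP; split; lra.
case: dE => d1 d2; have := cos_le d1 d2; have := cos_lt1 d1; lra.
Qed.

Lemma cis_surj (z : R[i]) : rnorm z = 1 -> exists2 t, 0 <= t < 1 & z = cis t.
Proof.
have p0 := @pi_gt0 R.
move=> z1; have := sqr_rnorm z; rewrite z1 expr1n; case: z {z1} => a b /= ab.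
have a1 : -1 <= a <= 1 by apply/andP; split; nra.
have ca : cos (acos a) = a by rewrite acosK ?in_itv.
have sa : sin (acos a) = `|b|.
  by rewrite sin_acos// (_ : 1 - a ^+ 2 = b ^+ 2) ?sqrtr_sqr//; lra.
have p20 : 2 * pi != 0 :> R by rewrite gt_eqF// mulr_gt0.
have E : 2 * pi * (acos a / (2 * pi)) = acos a by rewrite mulrC divfK.
have ac0 := acos_ge0 a1; have acp := acos_lepi a1.
have [b0|b0] := leP 0 b.
  exists (acos a / (2 * pi)); last by rewrite /cis E ca sa ger0_norm.
  by rewrite divr_ge0 ?mulr_ge0 ?pi_ge0//= ltr_pdivrMr ?mulr_gt0//; lra.
exists (1 - acos a / (2 * pi)).
  have acgt : 0 < acos a.
    rewrite lt_def ac0 andbT; apply: contraTneq b0 => a0.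
    by move: sa; rewrite a0 sin0 => /esym/eqP; rewrite normr_eq0 => /eqP->; rewrite ltxx.
  rewrite subr_ge0 ler_pdivrMr ?mulr_gt0// gtrBl divr_gt0 ?mulr_gt0// andbT; lra.
rewrite cisD cis1 mul1r cisN /cis E/= ca sa ltr0_norm//.
by rewrite opprK.
Qed.

(** The chord depends only on [s - t], so continuity of cosine at 0 is already uniform. *)
Lemma cis_unif e : 0 < e -> exists2 d, 0 < d &
  forall s t, `|s - t| < d -> rnorm (cis s - cis t) < e.
Proof.
move=> e0.
have cc : {for 0, continuous (fun t : R => cos (2 * pi * t))}.
  apply: (@continuous_comp _ _ _ (fun t : R => 2 * pi * t)).
    exact: mulrl_continuous.
  exact: continuous_cos.
have [|d /= d0 dd] := (@cvgrPdist_lt _ _ _ _ _ _ _).1 cc (e ^+ 2 / 2).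
  by rewrite divr_gt0// exprn_gt0.
exists d => // s t st.
rewrite -(@ltr_pXn2r _ 2) ?nnegrE ?rnorm_ge0 ?(ltW e0)// sqr_rnorm_cisB.
have := dd (s - t); rewrite /= sub0r normrN => /(_ st).
rewrite mulr0 cos0 => /(le_lt_trans (ler_norm _)); lra.
Qed.

Lemma continuous_cis : continuous (cis : R -> R[i]^o).
Proof.
move=> t; apply/cvgrPdist_lt => e /pos_complexE[-> /cis_unif[d d0 dd]].
near=> s; rewrite (@rnormE _ R[i]) ltcR; apply: dd.
near: s; exists d => //.
Unshelve. all: end_near.
Qed.

Definition cis_arc s t : set (borelC R) := cis @` `[s, t].

Lemma measurable_cis_arc s t : measurable (cis_arc s t).
Proof.
rewrite -[cis_arc s t]setCK; apply: measurableC; apply: sub_sigma_algebra.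
rewrite openC; apply: (@compact_closed R[i]^o); first exact: norm_hausdorff.
apply: continuous_compact; last exact: segment_compact.
exact/continuous_subspaceT/continuous_cis.
Qed.

Lemma measurable_cis_preimage (D : set (borelC R)) :
  measurable D -> measurable (cis @^-1` D : set (measurableTypeR R)).
Proof.
move=> mD; rewrite -[X in measurable X]setTI.
suff : measurable_fun setT (cis : measurableTypeR R -> borelC R) by exact.
apply: (@measurability _ _ (measurableTypeR R) (borelC R) setT cis
  (@open R[i]^o) erefl) => _ [B oB <-].
rewrite setTI; apply: measurable_realfun.open_measurable.
by apply: open_comp => // t _; exact: continuous_cis.
Qed.

End Circle.

Section DFT.
Context {R : realType} {H : completeNormedModType R[i]}.
Context {dot : {dot H for Num.conj}}.
Hypothesis dot_norm : forall u : H, dot u u = `|u| ^+ 2.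

Lemma rnorm_sqr_sum n (F : nat -> H) :
  rnorm (\sum_(k < n) F k) ^+ 2 =
  \sum_(k < n) \sum_(l < n) complex.Re (dot (F k) (F l)).
Proof.
rewrite -[LHS]/(complex.Re (rnorm _ ^+ 2)%:C%C) -(dotE dot_norm).
rewrite linear_sumlz Re_sum; apply: eq_bigr => k _.
by rewrite linear_sumr Re_sum.
Qed.

(** A geometric sum of ratio [z] with [z^N = 1]; injectivity of [cis] on [[0, 1)] gives [z != 1]. *)
Lemma roots_sum0 (N k l : nat) : (k < N)%N -> (l < N)%N -> k != l ->
  \sum_(j < N) @cis R (k%:R * (j%:R / N%:R)) * conjc (cis (l%:R * (j%:R / N%:R))) = 0.
Proof.
move=> kN lN kl.
have N0 : N%:R != 0 :> R by rewrite pnatr_eq0 -lt0n (leq_trans _ kN).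
pose z : R[i] := cis (k%:R / N%:R) * conjc (cis (l%:R / N%:R)).
have zE j : @cis R (k%:R * (j%:R / N%:R)) * conjc (cis (l%:R * (j%:R / N%:R))) = z ^+ j.
  rewrite /z -!cisN -!cisD -cis_muln; congr cis; field; exact: N0.
under eq_bigr => j _ do rewrite zE.
have zN : z ^+ N = 1.
  rewrite -zE divff// !mulr1 !cis_nat.
  by rewrite mul1r -cis0 -cisN oppr0.
apply/eqP; have /eqP := subrX1 z N; rewrite zN subrr eq_sym mulf_eq0 => /orP[|//].
rewrite subr_eq0 => /eqP z1; exfalso; move/eqP: kl; apply.
have Ngt0 : 0 < N%:R :> R by rewrite lt_def N0 ler0n.
have frac m : (m < N)%N -> 0 <= m%:R / N%:R < (1 : R).
  by move=> mN; rewrite divr_ge0//= ltr_pdivrMr// mul1r ltr_nat.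
have /(mulIf (invr_neq0 N0))/eqP : k%:R / N%:R = l%:R / N%:R :> R.
  apply: cis_inj; rewrite ?frac//.
  have := congr1 (fun w => w * cis (l%:R / N%:R)) z1.
  by rewrite /= mul1r -mulrA [conjc _ * _]mulrC mulcJ rnorm_cis expr1n mulr1.
by rewrite eqr_nat => /eqP.
Qed.

(** In the expanded squares the off-diagonal terms cancel by [roots_sum0]. The shift [s] contributes
    only a factor independent of [j]; it lets the grid start anywhere on the circle. *)
Lemma dft_parseval (N : nat) (s : R) (h : nat -> H) : (0 < N)%N ->
  \sum_(j < N) rnorm (\sum_(k < N) cis (k%:R * (s + j%:R / N%:R)) *: h k) ^+ 2
  = N%:R * \sum_(k < N) rnorm (h k) ^+ 2.
Proof.
move=> N0.
under eq_bigr => j _ do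
  rewrite (rnorm_sqr_sum N (fun k => cis (k%:R * (s + j%:R / N%:R)) *: h k)).
rewrite exchange_big/= mulr_sumr; apply: eq_bigr => k _.
rewrite exchange_big/= (bigD1 k)//= [X in _ + X]big1 ?addr0.
  under eq_bigr => j _ do
    rewrite (dotE dot_norm) rnormZ rnorm_cis mul1r.
  by rewrite sumr_const card_ord mulr_natl.
move=> l lk.
rewrite -Re_sum [X in complex.Re X](_ : _ = 0)//.
have E (j : 'I_N) : dot (cis (k%:R * (s + j%:R / N%:R)) *: h k)
    (cis (l%:R * (s + j%:R / N%:R)) *: h l) =
  (cis (k%:R * (j%:R / N%:R)) * conjc (cis (l%:R * (j%:R / N%:R)))) *
  (cis (k%:R * s) * conjc (cis (l%:R * s)) * dot (h k) (h l)).
  rewrite dotZl dotZr !mulrDr !cisD rmorphM/=; ring.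
under eq_bigr => j _ do rewrite E.
by rewrite -mulr_suml roots_sum0 ?mul0r// eq_sym.
Qed.

End DFT.

(** * Spectral measures *)

Section SpectralMeasure.
Context {R : realType} {H : completeNormedModType R[i]}.
Context {dot : {dot H for Num.conj}}.
Hypothesis dot_norm : forall u : H, dot u u = `|u| ^+ 2.
Context {E : set (borelC R) -> {linear H -> H}}.
Hypothesis E_pvm : projection_valued_measure dot E.
Implicit Types (u v : H) (D : set (borelC R)).

Lemma pvm_orth D1 D2 u v : measurable D1 -> measurable D2 ->
  D1 `&` D2 = set0 -> dot (E D1 u) (E D2 v) = 0.
Proof.
move=> m1 m2 D12; rewrite (pvm_selfadj E_pvm)// -(pvm_setI E_pvm)// D12.
by rewrite (pvm_set0 E_pvm) linear0r.
Qed.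

Lemma sqr_rnorm_pvm D u : measurable D ->
  rnorm (E D u) ^+ 2 = complex.Re (dot (E D u) u).
Proof.
move=> mD; rewrite -[LHS]/(complex.Re (rnorm (E D u) ^+ 2)%:C%C) -(dotE dot_norm).
by rewrite [in LHS](pvm_selfadj E_pvm)// (pvm_idem E_pvm)// -(pvm_selfadj E_pvm).
Qed.

(** [mu_diag E u D] is the real part of [dot (E D u) u], which is additive and continuous in
    [E D u], so strong additivity of [E] carries over. *)
Lemma mu_diag_semi_sigma_additive u : semi_sigma_additive (mu_diag E u).
Proof.
move=> F mF tF mUF; rewrite /mu_diag.
have -> : (fun n => \sum_(0 <= i < n) (rnorm (E (F i) u) ^+ 2)%:E)%E =
    EFin \o (fun n => complex.Re (dot (series (fun n => E (F n) u) n) u)).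
  apply/funext => n /=; rewrite sumEFin /series/= linear_sumlz Re_sum.
  by congr EFin; apply: eq_bigr => i _; rewrite sqr_rnorm_pvm.
apply: cvg_EFin; first by near=> n.
rewrite sqr_rnorm_pvm//; apply/cvgrPdist_lt => e e0.
have /cvgrPdist_lt h := pvm_bigcup E_pvm mF tF (u := u).
have e' : 0 < e / (rnorm u + 1).
  by rewrite divr_gt0// ltr_wpDl// rnorm_ge0.
have {}h := h (e / (rnorm u + 1))%:C%C; rewrite ltcR in h.
have {}h := h e'; near=> n; rewrite /=.
have {}hn : rnorm (E (\bigcup_n F n) u - series (fun n => E (F n) u) n) < e / (rnorm u + 1).
  by rewrite -ltcR -rnormE; near: n.
rewrite -ReN -ReD -[X in `|complex.Re X|]linearBl.
rewrite (le_lt_trans (normr_Re _))// (le_lt_trans (CauchySchwarz_dot dot_norm _ _))//.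
have u0 := rnorm_ge0 u.
rewrite (@le_lt_trans _ _ (e / (rnorm u + 1) * rnorm u))//.
  by rewrite ler_wpM2r// ltW.
by rewrite -mulrA gtr_pMr// mulrC ltr_pdivrMr ?mul1r; lra.
Unshelve. all: end_near.
Qed.

Lemma mu_diag_set0 u : mu_diag E u set0 = 0%E.
Proof. by rewrite /mu_diag (pvm_set0 E_pvm) rnorm0 expr0n. Qed.

Lemma mu_diag_ge0 u D : (0 <= mu_diag E u D)%E.
Proof. by rewrite lee_fin sqr_ge0. Qed.

(* Both structures below are carried by [mu_diag E u] itself, so integrals
   against them are convertible to the integrals in [spectral_measure_of]. *)
Definition mu_diag_measure u : {measure set (borelC R) -> \bar R} :=
  HB.pack (mu_diag E u : set (borelC R) -> \bar R)
  (isMeasure.Build _ _ _ (mu_diag E u) (mu_diag_set0 u) (mu_diag_ge0 u)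
     (mu_diag_semi_sigma_additive (u := u))).

Lemma mu_diag_fin u : fin_num_fun (mu_diag_measure u).
Proof. by []. Qed.

Definition mu_diag_finite u : {finite_measure set (borelC R) -> \bar R} :=
  HB.pack (mu_diag E u : set (borelC R) -> \bar R)
  (Measure.class (mu_diag_measure u))
  (Measure_isFinite.Build _ _ _ (mu_diag_measure u) (mu_diag_fin u)).

End SpectralMeasure.

Section PVM.
Context {R : realType} {H : completeNormedModType R[i]}.
Context {dot : {dot H for Num.conj}}.
Hypothesis dot_norm : forall u : H, dot u u = `|u| ^+ 2.
Context {E : set (borelC R) -> {linear H -> H}}.
Hypothesis E_pvm : projection_valued_measure dot E.
Implicit Types (u v : H) (D : set (borelC R)).

Lemma pvmU D1 D2 u : measurable D1 -> measurable D2 -> D1 `&` D2 = set0 ->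
  E (D1 `|` D2) u = E D1 u + E D2 u.
Proof.
move=> m1 m2 D12.
have mF i : measurable (bigcup2 D1 D2 i) by case: i => [|[|i]] //=; exact: measurable0.
have tF : trivIset setT (bigcup2 D1 D2) by rewrite -trivIset_bigcup2.
have := pvm_bigcup E_pvm mF tF (u := u); rewrite bigcup2E => EF.
apply: (cvg_unique _ EF); first exact: norm_hausdorff.
apply: cvg_near_cst; exists 2%N => // n /= n2.
rewrite /series/= -(subnKC n2) addSn add1n big_nat_recl//= big_nat_recl//= addrA.
by rewrite big1 ?addr0// => i _; rewrite (pvm_set0 E_pvm).
Qed.

Lemma pvmC D u : measurable D -> E (~` D) u = u - E D u.
Proof.
move=> mD; apply/eqP; rewrite eq_sym subr_eq addrC -pvmU ?setICr//.
  by rewrite setUCr (pvm_setT E_pvm).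
exact: measurableC.
Qed.

Lemma sqr_rnorm_pvmC D u : measurable D ->
  rnorm u ^+ 2 = rnorm (E D u) ^+ 2 + rnorm (E (~` D) u) ^+ 2.
Proof.
move=> mD; rewrite -(sqr_rnormD_orth dot_norm).
  by rewrite (pvmC u mD) addrC subrK.
by apply: (pvm_orth E_pvm) => //; rewrite ?setICr//; exact: measurableC.
Qed.

Lemma rnorm_pvm_le D u : measurable D -> rnorm (E D u) <= rnorm u.
Proof.
move=> mD; rewrite -(@ler_pXn2r _ 2) ?nnegrE ?rnorm_ge0//.
by rewrite (sqr_rnorm_pvmC u mD) lerDl sqr_ge0.
Qed.

Lemma mu_diag_setC D v : measurable D -> E D v = v -> mu_diag E v (~` D) = 0%E.
Proof. by move=> mD Dv; rewrite /mu_diag pvmC// Dv subrr rnorm0 expr0n. Qed.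

Context {A : {linear H -> H}}.
Hypothesis A_unitary : unitary dot A.
Hypothesis E_spectral : spectral_measure_of dot A E.

Let muE v : (mu_diag_finite dot_norm E_pvm v : set _ -> _) = mu_diag E v.
Proof. by []. Qed.

(** If [D] lies in a half-plane, so does the numerical range of [A] on the range of [E D]: for such
    [v] the measure [mu_diag E v] vanishes off [D], and the integrand is bounded by [m] on [D]. *)
Lemma quadratic_form_le D v (a b m : R) : measurable D -> E D v = v ->
  (forall z : R[i], D z -> a * complex.Re z + b * complex.Im z <= m) ->
  a * complex.Re (dot (A v) v) + b * complex.Im (dot (A v) v) <= m * rnorm v ^+ 2.
Proof.
move=> mD Dv Dm; have [_ /(_ v)[iRe iIm ->]] := E_spectral => /=.
rewrite -(muE v) in iRe iIm *; set mu := mu_diag_finite _ _ _ in iRe iIm *.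
pose re (z : borelC R) := complex.Re (z : R[i]).
pose im (z : borelC R) := complex.Im (z : R[i]).
have mC := measurableC mD.
have mu0 : mu (~` D) = 0%E by exact: mu_diag_setC.
have restr (f : borelC R -> R) : mu.-integrable setT (EFin \o f) ->
    mu.-integrable D (EFin \o f) /\
    fine (\int[mu]_z (f z)%:E) = Rintegral mu D f.
  move=> fi; split.
    by apply: (integrableS measurableT) => //.
  rewrite /Rintegral (negligible_integral mC measurableT fi mu0).
  by rewrite setDE setCK setTI.
have [iR ->] := restr re iRe; have [iI ->] := restr im iIm.
rewrite -!RintegralZl// -RintegralD//.
- apply: (@le_trans _ _ (Rintegral mu D (cst m))).
    apply: le_Rintegral => //.
    + by apply: eq_integrable (integrableD mD (integrableZl mD a iR)
        (integrableZl mD b iI)).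
    + exact: finite_measure_integrable_cst.
  by rewrite Rintegral_cst// -[fine _]/(rnorm (E D v) ^+ 2) Dv.
- exact: eq_integrable (integrableZl mD a iR).
- exact: eq_integrable (integrableZl mD b iI).
Qed.

End PVM.

Lemma ReM (R : realType) (z w : R[i]) :
  complex.Re (z * w) = complex.Re z * complex.Re w - complex.Im z * complex.Im w.
Proof. by case: z; case: w. Qed.

(** * Commutation of [A] with its spectral measure, and concentration on the circle *)

Section SpectralTheory.
Context {R : realType} {H : completeNormedModType R[i]}.
Context {dot : {dot H for Num.conj}}.
Hypothesis dot_norm : forall u : H, dot u u = `|u| ^+ 2.
Context {A : {linear H -> H}}.
Hypothesis A_unitary : unitary dot A.
Context {E : set (borelC R) -> {linear H -> H}}.
Hypothesis E_spectral : spectral_measure_of dot A E.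
Implicit Types (u v : H) (D S : set (borelC R)).

Let E_pvm : projection_valued_measure dot E := E_spectral.1.

Lemma polarization (B : {linear H -> H}) u v :
  4 * complex.Re (dot (B u) v) =
  complex.Re (dot (B (u + v)) (u + v)) - complex.Re (dot (B (u - v)) (u - v))
  - complex.Im (dot (B (u + 'i%C *: v)) (u + 'i%C *: v))
  + complex.Im (dot (B (u - 'i%C *: v)) (u - 'i%C *: v)).
Proof.
rewrite ![B (_ - _)]linearB ![B (_ + _)]linearD/= ![B (_ *: _)]linearZ/=.
rewrite ![dot (_ + _) _]linearDl/= ![dot (- _) _]linearNl/=
  ![dot _ (_ + _)]linearDr/= ![dot _ (- _)]linearNr/= !dotZl !dotZr.
move: (dot (B u) u) (dot (B u) v) (dot (B v) u) (dot (B v) v).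
move=> [a1 a2] [b1 b2] [c1 c2] [d1 d2] /=; ring.
Qed.

Lemma sqr_rnorm_pvm_ort D S u v (c : R[i]) : measurable D -> measurable S ->
  rnorm c = 1 ->
  rnorm (E S (E D u + c *: E (~` D) v)) ^+ 2 =
  rnorm (E S (E D u)) ^+ 2 + rnorm (E S (E (~` D) v)) ^+ 2.
Proof.
move=> mD mS c1; rewrite linearD linearZ/= (sqr_rnormD_orth dot_norm).
  by rewrite rnormZ c1 mul1r.
have mC := measurableC mD.
rewrite dotZr -!(pvm_setI E_pvm)// (pvm_orth E_pvm) ?mulr0//; try exact: measurableI.
by rewrite setIACA setICr setI0.
Qed.

(* [mu_diag E (E D u + c *: E (~` D) v)] does not depend on the unimodular
   [c], hence neither does the quadratic form of [A]; polarizing gives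
   [dot_pvm_ort]. *)
Lemma form_pvm_ort D u v (c : R[i]) : measurable D -> rnorm c = 1 ->
  dot (A (E D u + c *: E (~` D) v)) (E D u + c *: E (~` D) v) =
  dot (A (E D u + E (~` D) v)) (E D u + E (~` D) v).
Proof.
move=> mD c1; set w := E D u + _; set w' := E D u + _.
have ww' S : measurable S -> S `<=` setT -> mu_diag E w S = mu_diag E w' S.
  move=> mS _; rewrite /mu_diag sqr_rnorm_pvm_ort//.
  by rewrite /w' -[E (~` D) v]scale1r sqr_rnorm_pvm_ort ?rnorm1// scale1r.
have [_ _ ->] := E_spectral.2 w; have [_ _ ->] := E_spectral.2 w'.
have W f := @eq_measure_integral _ _ _ setT (mu_diag_measure dot_norm E_pvm w')
  (mu_diag_measure dot_norm E_pvm w) f ww'.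
by congr Complex; congr fine; apply: W.
Qed.

Lemma dot_pvm_ort D u v : measurable D -> dot (A (E D u)) (E (~` D) v) = 0.
Proof.
move=> mD.
(* The four forms in [polarization] belong to the unimodular factors [1], [-1], [i], [-i], hence
   coincide by [form_pvm_ort] and cancel in pairs. *)
have ReO v' : complex.Re (dot (A (E D u)) (E (~` D) v')) = 0.
  have i1 : rnorm ('i%C : R[i]) = 1.
    by rewrite /rnorm/= expr0n expr1n add0r sqrtr1.
  apply: (@mulfI _ 4); first by rewrite pnatr_eq0.
  have h (c : R[i]) := form_pvm_ort (c := c) u v' mD.
  rewrite polarization mulr0 -['i%C *: _]opprK -!scaleNr !opprK.
  rewrite -[- E (~` D) v']scaleN1r !h ?rnormN ?rnorm1//.
  by rewrite subrr add0r addNr.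
(* Replacing [v] by [i v] turns the real part into the imaginary part. *)
have := ReO ('i%C *: v); rewrite linearZ/= dotZr.
have := ReO v; case: (dot _ _) => a b /= ->.
by rewrite mul0r mulN1r opprK add0r => ->.
Qed.

Lemma pvm_comm D u : measurable D -> E D (A u) = A (E D u).
Proof.
move=> mD.
have ort S v : measurable S -> E (~` S) (A (E S v)) = 0.
  move=> mS; have mC := measurableC mS.
  apply/rnorm_eq0/eqP; rewrite -sqrf_eq0; apply/eqP.
  rewrite (sqr_rnorm_pvm dot_norm E_pvm)// (pvm_selfadj E_pvm)//.
  by rewrite dot_pvm_ort.
have mC := measurableC mD.
have uE : u = E D u + E (~` D) u by rewrite (pvmC E_pvm)// addrC subrK.
rewrite [in LHS]uE !linearD/=.
have := ort (~` D) u mC; rewrite setCK => ->; rewrite addr0.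
by have := ort D u mD; rewrite (pvmC E_pvm)// => /eqP; rewrite subr_eq0 => /eqP.
Qed.

Lemma pvm_range D v (l : R[i]) : measurable D -> E D v = v ->
  E D (A v - l *: v) = A v - l *: v.
Proof. by move=> mD Dv; rewrite linearB linearZ/= pvm_comm// Dv. Qed.

Lemma sqr_rnorm_sub v (w : R[i]) : rnorm (A v - w *: v) ^+ 2 =
  (1 + rnorm w ^+ 2) * rnorm v ^+ 2 -
  2 * (complex.Re w * complex.Re (dot (A v) v) + complex.Im w * complex.Im (dot (A v) v)).
Proof.
rewrite (sqr_rnormD dot_norm) rnormN rnormZ (unitary_iso dot_norm A_unitary).
rewrite linearNr/= dotZr ReN ReM; case: w => a b /=; ring.
Qed.

Lemma sqr_rnorm_circle (z w : R[i]) : rnorm z = 1 ->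
  rnorm (z - w) ^+ 2 = 1 + rnorm w ^+ 2 -
  2 * (complex.Re w * complex.Re z + complex.Im w * complex.Im z).
Proof.
move=> z1; have := sqr_rnorm z; rewrite z1 !sqr_rnorm.
case: z {z1} => a b; case: w => c d /=; lra.
Qed.

(** On the circle [|z - w|^2] is affine in the real and imaginary parts of [z]. As [A] is isometric,
    [|(A - w) v|^2] is the same expression with [dot (A v) v] for [z] and weight [|v|^2], so the
    claim is a half-plane condition. *)
Lemma pvm_lower D v (w : R[i]) (e : R) : measurable D -> D `<=` @unit_circle R ->
  E D v = v -> (forall z : R[i], D z -> e <= rnorm (z - w) ^+ 2) ->
  e * rnorm v ^+ 2 <= rnorm (A v - w *: v) ^+ 2.
Proof.
move=> mD DT Dv De.
have := @quadratic_form_le _ _ _ dot_norm _ E_pvm _ E_spectral D v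
  (complex.Re w) (complex.Im w) ((1 + rnorm w ^+ 2 - e) / 2) mD Dv.
rewrite sqr_rnorm_sub => h.
have : forall z : R[i], D z -> complex.Re w * complex.Re z +
    complex.Im w * complex.Im z <= (1 + rnorm w ^+ 2 - e) / 2.
  by move=> z Dz; have := De z Dz; rewrite (sqr_rnorm_circle _ (DT z Dz)); lra.
by move=> /h; lra.
Qed.

Lemma pvm_upper D v (w : R[i]) (e : R) : measurable D -> D `<=` @unit_circle R ->
  E D v = v -> (forall z : R[i], D z -> rnorm (z - w) ^+ 2 <= e) ->
  rnorm (A v - w *: v) ^+ 2 <= e * rnorm v ^+ 2.
Proof.
move=> mD DT Dv De.
have := @quadratic_form_le _ _ _ dot_norm _ E_pvm _ E_spectral D v
  (- complex.Re w) (- complex.Im w) ((e - (1 + rnorm w ^+ 2)) / 2) mD Dv.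
rewrite sqr_rnorm_sub => h.
have : forall z : R[i], D z -> - complex.Re w * complex.Re z +
    - complex.Im w * complex.Im z <= (e - (1 + rnorm w ^+ 2)) / 2.
  by move=> z Dz; have := De z Dz; rewrite (sqr_rnorm_circle _ (DT z Dz)); lra.
by move=> /h; lra.
Qed.

Definition closed_square (a b e : R) : set (borelC R) :=
  [set z : R[i] | `|complex.Re z - a| <= e /\ `|complex.Im z - b| <= e].

Lemma measurable_closed_square a b e : measurable (closed_square a b e).
Proof.
(* Measurability of the coordinates is read off their integrability; any vector would do in place of
   0. *)
have [iR iI _] := E_spectral.2 0.
have /measurable_realfun.measurable_EFinP mR := measurable_int _ iR.
have /measurable_realfun.measurable_EFinP mI := measurable_int _ iI.
rewrite [closed_square _ _ _](_ : _ =
    ([set: borelC R] `&`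
      (fun z : borelC R => complex.Re (z : R[i])) @^-1` `[a - e, a + e]) `&`
    ([set: borelC R] `&`
      (fun z : borelC R => complex.Im (z : R[i])) @^-1` `[b - e, b + e])).
  by apply: measurableI; [exact: mR|exact: mI].
rewrite !setTI; apply/seteqP; split=> z; rewrite /closed_square/= !in_itv/= !ler_distl => -[]//.
Qed.

(** With [v = (A - c) u], polarization will give [|v|^2 <= e (|u|^2 + |v|^2)], hence
    [|v|^2 <= 2 e |u|^2] as [e <= 1/2]. The second inequality makes this incompatible with
    [(1 - |c|)^2 |u|^2 <= |v|^2] unless [u = 0]. *)
Definition off_circle (a b e : R) :=
  (0 < e <= 1 / 2) && (2 * e < (1 - rnorm (Complex a b)) ^+ 2).

(* With [c := Complex a b], on the range of [E (closed_square a b e)] the real and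
   imaginary parts of the quadratic form of [A - c] are at most [e], so by
   polarization [A - c] is small there, whereas [A - c] is bounded below by
   [`|1 - rnorm c|] because [A] is isometric. *)
Lemma pvm_closed_square0 (a b e : R) u : off_circle a b e -> E (closed_square a b e) u = 0.
Proof.
move=> /andP[/andP[e0 e1] ab]; set c := Complex a b in ab; set D := closed_square a b e.
have mD : measurable D := measurable_closed_square a b e.
set u' := E D u; have Du' : E D u' = u' by rewrite (pvm_idem E_pvm).
have form w : E D w = w ->
    `|complex.Re (dot (A w - c *: w) w)| <= e * rnorm w ^+ 2 /\
    `|complex.Im (dot (A w - c *: w) w)| <= e * rnorm w ^+ 2.
  move=> Dw; have Q := @quadratic_form_le _ _ _ dot_norm _ E_pvm _ E_spectral D w.
  have h1 := Q 1 0 (a + e) mD Dw; have h2 := Q (-1) 0 (e - a) mD Dw.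
  have h3 := Q 0 1 (b + e) mD Dw; have h4 := Q 0 (-1) (e - b) mD Dw.
  have sq z : D z -> [/\ a - e <= complex.Re (z : R[i]), complex.Re (z : R[i]) <= a + e,
      b - e <= complex.Im (z : R[i]) & complex.Im (z : R[i]) <= b + e].
    by rewrite /D /closed_square/= !ler_distl => -[/andP[? ?] /andP[? ?]].
  have {}h1 := h1 (fun z zD => ltac:(by case: (sq z zD) => *; lra)).
  have {}h2 := h2 (fun z zD => ltac:(by case: (sq z zD) => *; lra)).
  have {}h3 := h3 (fun z zD => ltac:(by case: (sq z zD) => *; lra)).
  have {}h4 := h4 (fun z zD => ltac:(by case: (sq z zD) => *; lra)).
  rewrite linearBl/= dotZl (dotE dot_norm); move: h1 h2 h3 h4.
  case: (dot (A w) w) => p q /=; rewrite !ler_norml.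
  by split; apply/andP; split; lra.
pose B : {linear H -> H} := (A \- c \*: idfun).
have BE w : B w = A w - c *: w by [].
set v := B u'.
have Dv : E D v = v by rewrite /v BE pvm_range.
(* Polarizing [dot (B u') v = |v|^2] costs at most [e] times the sum of [|u' + z v|^2] over the four
   powers [z] of [i]; by the parallelogram law that sum is [4 (|u'|^2 + |v|^2)]. *)
have vv : rnorm v ^+ 2 <= e * (rnorm u' ^+ 2 + rnorm v ^+ 2).
  have := polarization B u' v; rewrite (dotE dot_norm)/=.
  have Dw z : E D (u' + z *: v) = u' + z *: v by rewrite linearD linearZ/= Du' Dv.
  have [r1 _] := form _ (Dw 1); have [r2 _] := form _ (Dw (-1)).
  have [_ r3] := form _ (Dw 'i%C); have [_ r4] := form _ (Dw (- 'i%C)).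
  move: r1 r2 r3 r4; rewrite -!BE !scaleNr !scale1r => r1 r2 r3 r4.
  have par (x y : H) : rnorm (x + y) ^+ 2 + rnorm (x - y) ^+ 2 =
      2 * (rnorm x ^+ 2 + rnorm y ^+ 2).
    rewrite !(sqr_rnormD dot_norm) rnormN linearNr/= ReN; ring.
  have p1 := par u' v; have p2 := par u' ('i%C *: v).
  have i1 : rnorm ('i%C : R[i]) = 1.
    by rewrite /rnorm/= expr0n expr1n add0r sqrtr1.
  rewrite rnormZ i1 mul1r in p2.
  move: r1 r2 r3 r4; rewrite !ler_norml => /andP[? ?] /andP[? ?] /andP[? ?] /andP[? ?].
  by rewrite /=; nra.
have := iso_lower (unitary_iso dot_norm A_unitary) c u'; rewrite -BE -/v => low.
have low2 : (1 - rnorm c) ^+ 2 * rnorm u' ^+ 2 <= rnorm v ^+ 2.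
  rewrite -[(1 - _) ^+ 2]real_normK ?num_real// -exprMn.
  by rewrite ler_pXn2r ?nnegrE ?mulr_ge0 ?rnorm_ge0.
apply/rnorm_eq0/eqP; rewrite -sqrf_eq0; apply/eqP/le_anti; rewrite sqr_ge0 andbT.
have v2 := sqr_ge0 (rnorm v); have u2 := sqr_ge0 (rnorm u').
by rewrite -/u' leNgt; apply/negP => u'0; nra.
Qed.

Lemma unit_circleE : @unit_circle R = cis_arc 0 1.
Proof.
apply/seteqP; split=> [z z1|z [t _ <-]]; last exact: rnorm_cis.
have [t /andP[t0 t1] ->] := cis_surj z1.
by exists t => //=; rewrite in_itv/= t0 ltW.
Qed.

Lemma measurable_unit_circle : measurable (@unit_circle R).
Proof. by rewrite unit_circleE; exact: measurable_cis_arc. Qed.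

Lemma closed_square_cover (z : R[i]) : rnorm z != 1 -> exists (n : nat) (i j : int),
  let e : R := n.+1%:R^-1 in
  off_circle (i%:~R * e) (j%:~R * e) e /\ closed_square (i%:~R * e) (j%:~R * e) e z.
Proof.
move=> z1; pose d : R := `|1 - rnorm z|.
have d0 : 0 < d by rewrite normr_gt0 subr_eq0 eq_sym.
(* The centre [c] will be within [2 e] of [z], so [(d - 2 e)^2 > 2 e] is wanted; [e (4 d + 2) < d^2]
   ensures it. *)
pose m : R := Num.min (1 / 2) (d ^+ 2 / (4 * d + 2)).
have m0 : 0 < m.
  by rewrite lt_min !divr_gt0 ?exprn_gt0//; lra.
have [n nm] : exists n, n.+1%:R^-1 < m.
  have := near_infty_natSinv_lt (PosNum m0) => -[n _ /(_ n (leqnn _))] /= h.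
  by exists n.
set e : R := n.+1%:R^-1 in nm *.
have e0 : 0 < e by rewrite invr_gt0.
have ne : n.+1%:R * e = 1 by rewrite /e divff.
have fl (x : R) : `|x - (Num.floor (n.+1%:R * x))%:~R * e| <= e.
  have := floor_itv (n.+1%:R * x); rewrite intrD mulr1z => /andP[h1 h2].
  set f := Num.floor _ in h1 h2 *.
  have -> : x - f%:~R * e = (n.+1%:R * x - f%:~R) * e by rewrite mulrBl mulrAC ne mul1r.
  rewrite normrM (ger0_norm (ltW e0)) ler_piMl ?(ltW e0)// ger0_norm ?subr_ge0//.
  by rewrite lerBlDl ltW.
exists n, (Num.floor (n.+1%:R * complex.Re z)), (Num.floor (n.+1%:R * complex.Im z)).
have fR := fl (complex.Re z); have fI := fl (complex.Im z).
rewrite lt_min in nm; have /andP[e12 ed] := nm.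
rewrite /= -/e; split=> //; rewrite /off_circle e0 (ltW e12)/=.
set c := Complex _ _.
have zc : rnorm (z - c) <= 2 * e.
  rewrite -(@ler_pXn2r _ 2) ?nnegrE ?rnorm_ge0 ?mulr_ge0 ?(ltW e0)// sqr_rnorm.
  move: fR fI; rewrite !ler_norml /c; case: (z) => p q /= /andP[? ?] /andP[? ?].
  nra.
have h1 := lerB_rnorm z c; have h2 := lerB_rnorm c z; rewrite rnormC in h2.
have hd : d - 2 * e <= `|1 - rnorm c|.
  rewrite lerBlDr /d (le_trans (_ : _ <= `|1 - rnorm c| + `|rnorm c - rnorm z|))//.
    by rewrite (le_trans _ (ler_normD _ _))// addrA subrK.
  rewrite lerD2l ler_norml; apply/andP; split; lra.
rewrite ltr_pdivlMr in ed; last lra.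
rewrite -[ltRHS]real_normK ?num_real//.
apply: (@lt_le_trans _ _ ((d - 2 * e) ^+ 2)); first nra.
have de : 0 <= d - 2 * e by nra.
by rewrite ler_pXn2r ?nnegrE.
Qed.

(** The complement of the circle is covered by countably many grid squares, each null for
    [mu_diag E u] by [pvm_closed_square0]. *)
Lemma pvm_unit_circle u : E (@unit_circle R) u = u.
Proof.
have mT := measurable_unit_circle; have mC := measurableC mT.
apply/eqP; rewrite eq_sym -subr_eq0 -(pvmC E_pvm)//; apply/eqP.
pose F k : set (borelC R) := if unpickle k is Some (n, i, j) then
  let e : R := (n : nat).+1%:R^-1 in
  let a := (i : int)%:~R * e in let b := (j : int)%:~R * e in
  if off_circle a b e then closed_square a b e else set0 else set0.
have EF k : mu_diag E u (F k) = 0%E /\ measurable (F k).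
  rewrite /F /mu_diag; case: unpickle => [[[n i] j]|] /=.
    case: ifP => [offT|_].
      split; last exact: measurable_closed_square.
      by rewrite pvm_closed_square0// rnorm0 expr0n.
    by split; rewrite ?(pvm_set0 E_pvm) ?rnorm0 ?expr0n.
  by split; rewrite ?(pvm_set0 E_pvm) ?rnorm0 ?expr0n.
pose mu := mu_diag_measure dot_norm E_pvm u.
have : mu.-negligible (~` @unit_circle R).
  apply: (@negligibleS _ _ _ _ (\bigcup_k F k)); last first.
    apply: negligible_bigcup => k; have [F0 mF] := EF k.
    by apply/negligibleP.
  move=> z /eqP z1; have [n [i [j [offT zn]]]] := closed_square_cover z1.
  by exists (pickle (n, i, j)) => //; rewrite /F pickleK /= offT.
move=> /negligibleP => /(_ mC) -[]/eqP; rewrite sqrf_eq0 => /eqP; exact: rnorm_eq0.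
Qed.

End SpectralTheory.

(** * From resolvent bounds to measure bounds *)

(** Counts the grid points in an arc; the extra 1 is due to [j = 0] and disappears after division by
    [N]. *)
Lemma count_ord_le (R : realFieldType) (N : nat) (M : R) : 0 <= M ->
  \sum_(j < N) (j%:R <= M)%R%:R <= M + 1.
Proof.
move=> M0; elim: N => [|N ih]; first by rewrite big_ord0 addr_ge0.
rewrite big_ord_recr/=; have [NM|_] := leP N%:R M; last by rewrite addr0.
rewrite lerD2r (le_trans _ NM)// (le_trans (ler_sum _ (G := fun=> 1) _))//.
  by move=> i _; rewrite lern1 leq_b1.
by rewrite sumr_const card_ord.
Qed.

(** Lets [N] tend to infinity in the finite averages: [r^N] and [1/N] both vanish. *)
Lemma le_of_expr_limit (R : realType) (U L C K r : R) : 0 < r < 1 ->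
  (forall N : nat, (0 < N)%N ->
    U * (1 - (r ^+ N) ^+ 2) <= (1 + r ^+ N) ^+ 2 * ((L + N%:R^-1) * C + K)) ->
  U <= L * C + K.
Proof.
move=> /andP[r0 r1] UK.
have rc : (fun N => r ^+ N.+1) @ \oo --> (0 : R).
  by rewrite (@cvg_shiftS _ (fun N => r ^+ N)); apply: cvg_expr; rewrite gtr0_norm.
have nc : (fun N : nat => N.+1%:R^-1) @ \oo --> (0 : R) by exact: cvg_harmonic.
have lc : (fun N : nat => U * (1 - (r ^+ N.+1) ^+ 2)) @ \oo --> U * (1 - 0 ^+ 2).
  by apply: cvgMr; apply: cvgB; [exact: cvg_cst|exact: cvgM].
have uc : (fun N : nat => (1 + r ^+ N.+1) ^+ 2 * ((L + N.+1%:R^-1) * C + K)) @ \oo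
    --> (1 + 0) ^+ 2 * ((L + 0) * C + K).
  apply: cvgM.
    by apply: cvgM; apply: cvgD => //; exact: cvg_cst.
  by apply: cvgD; [apply: cvgMl; apply: cvgD => //; exact: cvg_cst|exact: cvg_cst].
have := ler_cvg_to lc uc; rewrite expr0n/= subr0 mulr1 !addr0 expr1n mul1r.
by apply; near=> N; exact: UK.
Unshelve. all: end_near.
Qed.

Section ResolventToMeasure.
Context {R : realType} {H : completeNormedModType R[i]}.
Context {dot : {dot H for Num.conj}}.
Hypothesis dot_norm : forall u : H, dot u u = `|u| ^+ 2.
Context {A : {linear H -> H}}.
Hypothesis A_unitary : unitary dot A.
Context {E : set (borelC R) -> {linear H -> H}}.
Hypothesis E_spectral : spectral_measure_of dot A E.

Let E_pvm : projection_valued_measure dot E := E_spectral.1.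
Let A_iso := unitary_iso dot_norm A_unitary.

Lemma iter_sub_telescope n (l : R[i]) y :
  iter n A y - l ^+ n *: y =
  \sum_(k < n) l ^+ k *: iter (n - k.+1) A (A y - l *: y).
Proof.
pose f k := - (l ^+ k *: iter (n - k) A y).
pose t k := l ^+ k *: iter (n - k.+1) A (A y - l *: y).
rewrite -(big_mkord xpredT t) (@telescope_sumr_eq _ _ _ f)//.
  by rewrite /f subn0 subnn expr0 scale1r opprK addrC.
move=> k /= kn; rewrite /f /t opprK [RHS]addrC -(subnSK kn) iter_linB iter_linZ.
by rewrite -iterSr scalerBr scalerA -exprSr.
Qed.

(* With [w j] running over a coset of the [N]-th roots of unity,
   [(A ^ N - (r w) ^ N) (y j) = \sum_k w ^ k *: (r ^ k *: A ^ (N - 1 - k) u)],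
   and the discrete Parseval identity averages the right-hand side exactly. *)
Lemma resolvent_average N (r s : R) (u : H) (y : 'I_N -> H) : (0 < N)%N -> 0 < r ->
  (forall j, A (y j) - (r%:C%C * cis (s + j%:R / N%:R)) *: y j = u) ->
  N%:R * (rnorm u ^+ 2 * \sum_(k < N) (r ^+ 2) ^+ k) <=
  (1 + r ^+ N) ^+ 2 * \sum_(j < N) rnorm (y j) ^+ 2.
Proof.
move=> N0 r0 yu.
have -> : rnorm u ^+ 2 * \sum_(k < N) (r ^+ 2) ^+ k =
    \sum_(k < N) rnorm (r%:C%C ^+ k *: iter (N - k.+1) A u) ^+ 2.
  rewrite mulr_sumr; apply: eq_bigr => k _.
  by rewrite rnormZ rnormX rnorm_real gtr0_norm// rnorm_iter// exprMn; ring.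
have /= <- := dft_parseval dot_norm s (fun k => r%:C%C ^+ k *: iter (N - k.+1) A u) N0.
rewrite mulr_sumr; apply: ler_sum => j _.
set w := cis (s + j%:R / N%:R).
have -> : \sum_(k < N) cis (k%:R * (s + j%:R / N%:R)) *: (r%:C%C ^+ k *: iter (N - k.+1) A u) =
    iter N A (y j) - (r%:C%C * w) ^+ N *: y j.
  rewrite iter_sub_telescope; apply: eq_bigr => k _.
  by rewrite yu scalerA cis_muln -/w exprMn mulrC.
rewrite -exprMn ler_pXn2r ?nnegrE ?rnorm_ge0 ?mulr_ge0 ?rnorm_ge0 ?addr_ge0
  ?exprn_ge0 ?(ltW r0)//.
rewrite (le_trans (rnormB _ _))// rnorm_iter// rnormZ rnormX rnormM rnorm_cis mulr1.
by rewrite rnorm_real gtr0_norm// mulrDl mul1r.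
Qed.

Variables (x : H) (C : R).
Hypothesis C_gt0 : 0 < C.
Hypothesis resC : forall l : R[i], rnorm l <> 1 ->
  rnorm (resolvent A l x) ^+ 2 <= C * `|1 - rnorm l ^+ 2|^-1.

(* Only the points [w j] in the arc enlarged by [d] see the bound on the
   resolvent; at the others [A - w j] is bounded below by [eta] on the range
   of [E (cis_arc a b)]. *)
Lemma cis_arc_bound_approx (a b d p : R) (eta := Num.sqrt (2 - 2 * cos (2 * pi * d))) :
  a <= b -> 0 < d <= 1 / 2 -> 0 < p < 1 -> p <= eta / 2 ->
  rnorm (E (cis_arc a b) x) ^+ 2 <=
  (b - a + 2 * d) * C + p * (8 * rnorm (E (cis_arc a b) x) ^+ 2 / eta ^+ 2).
Proof.
move=> ab d01 /andP[p0 p1] peta; have /andP[d0 d1] := d01.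
set I := cis_arc a b; have mI : measurable I := measurable_cis_arc a b.
set u := E I x; set U := rnorm u ^+ 2.
have cd := cos_lt1 d01.
have eta2 : eta ^+ 2 = 2 - 2 * cos (2 * pi * d) by rewrite sqr_sqrtr//; lra.
have eta0 : 0 < eta by rewrite sqrtr_gt0; lra.
have U0 : 0 <= U by rewrite sqr_ge0.
pose r := 1 - p; have r0 : 0 < r by rewrite subr_gt0.
have r1 : r < 1 by rewrite gtrBl.
have r2 : 0 < 1 - r ^+ 2 by rewrite subr_gt0 expr_lt1// ltW.
pose L := b - a + 2 * d; have L0 : 0 <= L by rewrite /L; lra.
have IT : I `<=` @unit_circle R by move=> _ [t _ <-]; exact: rnorm_cis.
apply: (@le_of_expr_limit _ _ _ _ _ r); first by rewrite r0.
(* The grid starts at the left end of the enlarged arc, whose points are then those with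
   [j <= N L]. *)
move=> N N0; pose s := a - d.
pose w (j : 'I_N) := cis (s + j%:R / N%:R).
pose l (j : 'I_N) := r%:C%C * w j.
have rl j : rnorm (l j) = r by rewrite rnormM rnorm_cis mulr1 rnorm_real gtr0_norm.
have l1 j : rnorm (l j) <> 1 by rewrite rl => r1'; move: r1; rewrite r1' ltxx.
pose y j := E I (resolvent A (l j) x).
have yu j : A (y j) - l j *: y j = u.
  rewrite /y -(pvm_comm dot_norm E_spectral)// -[_ *: E I _]linearZ/= -linearB/=.
  by rewrite (resolventK dot_norm A_unitary).
have N0R : 0 < N%:R :> R by rewrite ltr0n.
have NL0 : 0 <= N%:R * L by rewrite mulr_ge0// ltW.
have yb j : rnorm (y j) ^+ 2 <= C / (1 - r ^+ 2) * (j%:R <= N%:R * L)%R%:R + 4 * U / eta ^+ 2.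
  have [jL|jL] := leP j%:R (N%:R * L).
    rewrite mulr1 -[leLHS]addr0 lerD//; last first.
      by rewrite divr_ge0 ?sqr_ge0// mulr_ge0.
    have := resC (@l1 j); rewrite rl (gtr0_norm r2); apply: le_trans.
    by rewrite ler_pXn2r ?nnegrE ?rnorm_ge0// (rnorm_pvm_le dot_norm E_pvm).
  rewrite mulr0 add0r.
  have low : eta ^+ 2 * rnorm (y j) ^+ 2 <= rnorm (A (y j) - w j *: y j) ^+ 2.
    apply: (pvm_lower dot_norm A_unitary E_spectral mI IT).
      by rewrite /y (pvm_idem E_pvm).
    move=> _ [t + <-]; rewrite /= in_itv/= => /andP[ta tb].
    rewrite sqr_rnorm_cisB eta2 lerD2l lerN2 ler_wpM2l//.
    rewrite -cosN -mulrN opprB; apply: cos_le => //.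
    have jN : j%:R / N%:R < 1 :> R by rewrite ltr_pdivrMr// mul1r ltr_nat.
    have Lj : L < j%:R / N%:R by rewrite ltr_pdivlMr// mulrC.
    (* [L < j / N < 1] and [a <= t <= b] put [s + j / N - t] between [d] and [1 - d]. *)
    by rewrite /s; move: Lj jN; rewrite /L => *; apply/andP; split; lra.
  have lw : rnorm (A (y j) - w j *: y j) <= rnorm u + p * rnorm (y j).
    have -> : A (y j) - w j *: y j = u - (p%:C%C * w j) *: y j.
      rewrite -(yu j) /l -addrA -opprD -scalerDl -mulrDl -rmorphD/=.
      by rewrite /r subrK rmorph1 mul1r.
    by rewrite (le_trans (rnormB _ _))// rnormZ rnormM rnorm_cis mulr1 rnorm_real gtr0_norm.
  have y0 := rnorm_ge0 (y j); have u0 := rnorm_ge0 u.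
  have h1 : eta * rnorm (y j) <= rnorm (A (y j) - w j *: y j).
    by rewrite -(@ler_pXn2r _ 2) ?nnegrE ?rnorm_ge0 ?mulr_ge0 ?(ltW eta0)// exprMn.
  (* [p <= eta / 2] absorbs [p |y j|] into the left-hand side; this is the source of the constant
     4. *)
  have h2 : eta * rnorm (y j) <= 2 * rnorm u by nra.
  rewrite ler_pdivlMr ?exprn_gt0// mulrC -exprMn (_ : 4 * U = (2 * rnorm u) ^+ 2).
    by rewrite ler_pXn2r ?nnegrE ?mulr_ge0 ?(ltW eta0).
  by rewrite /U; ring.
have := @resolvent_average N r s u y N0 r0 yu.
have geo : \sum_(k < N) (r ^+ 2) ^+ k = (1 - (r ^+ N) ^+ 2) / (1 - r ^+ 2).
  apply: (@mulIf _ (1 - r ^+ 2)); first by rewrite gt_eqF.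
  rewrite divfK ?gt_eqF// mulrC -opprB mulNr -subrX1 opprB exprAC//.
rewrite geo -/U => h.
have sumy : \sum_(j < N) rnorm (y j) ^+ 2 <=
    C / (1 - r ^+ 2) * (N%:R * L + 1) + N%:R * (4 * U / eta ^+ 2).
  apply: le_trans (ler_sum _ (fun j _ => yb j)) _.
  rewrite big_split/=; apply: lerD; last by rewrite sumr_const card_ord -[leLHS]mulr_natl.
  by rewrite -mulr_sumr ler_wpM2l ?count_ord_le// divr_ge0// ltW.
have q0 : 0 <= (1 + r ^+ N) ^+ 2 by rewrite sqr_ge0.
have {sumy}h := le_trans h (ler_wpM2l q0 sumy).
have K0 : 0 <= 4 * U / eta ^+ 2 by rewrite divr_ge0 ?sqr_ge0// mulr_ge0.
have p2 : 1 - r ^+ 2 <= 2 * p by rewrite /r; nra.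
have {}h : U * (1 - (r ^+ N) ^+ 2) <=
    (1 + r ^+ N) ^+ 2 * ((L + N%:R^-1) * C + (1 - r ^+ 2) * (4 * U / eta ^+ 2)).
  have ns : 0 < N%:R / (1 - r ^+ 2) by rewrite divr_gt0.
  rewrite -(ler_pM2r ns); move: h (lt0r_neq0 r2) (lt0r_neq0 N0R).
  move: (4 * U / _) (1 - r ^+ 2) (N%:R) (r ^+ N) => K s' n q h s0 n0.
  by rewrite [leLHS](_ : _ = n * (U * ((1 - q ^+ 2) / s')));
    [rewrite (le_trans h)// le_eqVlt; apply/orP; left; apply/eqP|]; field; rewrite ?s0 ?n0.
apply: le_trans h _; rewrite ler_wpM2l// lerD2l.
have -> : p * (8 * U / eta ^+ 2) = (2 * p) * (4 * U / eta ^+ 2) by ring.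
by rewrite ler_wpM2r.
Qed.

(** For fixed [d], letting [p] tend to 0 removes the term with [eta]; then [d] tends to 0. *)
Lemma cis_arc_bound (a b : R) : a <= b ->
  (mu_diag E x (cis_arc a b) <= (C * (b - a))%:E)%E.
Proof.
move=> ab; rewrite lee_fin mulrC; set U := rnorm _ ^+ 2.
have U0 : 0 <= U by rewrite sqr_ge0.
suff dU d : 0 < d <= 1 / 2 -> U <= (b - a + 2 * d) * C.
  apply/ler_addgt0Pl => e e0.
  pose d := Num.min (1 / 2) (e / (2 * C)).
  have d0 : 0 < d <= 1 / 2.
    by rewrite lt_min ge_min lexx andbT !divr_gt0// mulr_gt0.
  apply: le_trans (dU _ d0) _; rewrite mulrDl addrC lerD2r.
  by rewrite -mulrA mulrCA -ler_pdivlMr ?mulr_gt0// /d ge_min lexx orbT.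
move=> d01; set eta := Num.sqrt (2 - 2 * cos (2 * pi * d)).
have eta0 : 0 < eta by rewrite sqrtr_gt0; have := cos_lt1 d01; lra.
apply/ler_addgt0Pl => e e0.
pose c := 8 * U / eta ^+ 2.
have c0 : 0 <= c by rewrite divr_ge0 ?sqr_ge0// mulr_ge0.
pose p := Num.min (1 / 2) (Num.min (eta / 2) (e / (c + 1))).
have c1 : 0 < c + 1 by rewrite ltr_wpDl.
have p0 : 0 < p by rewrite !lt_min !divr_gt0.
have p1 : p < 1 by rewrite gt_min; apply/orP; left; lra.
have := @cis_arc_bound_approx a b d p ab d01; rewrite p0 p1 -/eta -/U -/c => /(_ isT).
have -> : p <= eta / 2 by rewrite /p !ge_min lexx orbT.
move=> /(_ isT) h; have pe : p * (c + 1) <= e.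
  by rewrite -ler_pdivlMr// /p !ge_min lexx !orbT.
apply: le_trans h _; rewrite addrC lerD2r (le_trans _ pe)//.
by rewrite ler_wpM2l ?(ltW p0)// lerDl.
Qed.

(** Lebesgue measure is an infimum over countable covers by half-open intervals. The corresponding
    arcs cover [D], and subadditivity of [mu_diag E x] sums their bounds. *)
Lemma borel_bound (D : set (borelC R)) : measurable D -> D `<=` @unit_circle R ->
  (mu_diag E x D <= C%:E * arc_length D)%E.
Proof.
move=> mD DT; rewrite /arc_length; set X := (X in lebesgue_measure X).
rewrite muleC -lee_pdivrMr// muleC.
apply: le_ereal_inf_tmp => _ [F [mF XF] <-].
rewrite muleC lee_pdivrMr// muleC.
have G_ k : {G : set (borelC R) | [/\ measurable G, cis @` F k `<=` G &
    (mu_diag E x G <= C%:E * wlength idfun (F k))%E]}.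
  apply: cid; have [[a b] _ Fab] := mF k.
  have [ab|ba] := leP a b.
    exists (cis_arc a b); split; first exact: measurable_cis_arc.
      move=> _ [t + <-]; rewrite -Fab /= in_itv/= => /andP[/ltW ta tb].
      by exists t => //=; rewrite in_itv/= ta.
    by rewrite -Fab wlength_itv_bnd// -EFinM; exact: cis_arc_bound.
  have F0 : F k = set0.
    by rewrite -Fab; apply/seteqP; split => // t /=; rewrite in_itv/= => /andP[]; lra.
  exists set0; split => //; first by rewrite F0 image_set0.
  by rewrite F0 wlength0 mule0 /mu_diag (pvm_set0 E_pvm) rnorm0 expr0n.
pose G k := projT1 (G_ k).
have GP k : [/\ measurable (G k), cis @` F k `<=` G k &
    (mu_diag E x (G k) <= C%:E * wlength idfun (F k))%E] by exact: projT2 (G_ k).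
have DG : D `<=` \bigcup_k G k.
  move=> z Dz; have [t /andP[t0 t1] zt] := cis_surj (DT _ Dz).
  have [k _ Fk] : (\bigcup_k F k) t by apply: XF; rewrite /X/= t0 t1 -/(cis t) -zt.
  exists k => //; have [_ + _] := GP k; apply; exists t => //.
have mG k : measurable (G k) by have [] := GP k.
have := @measure_sigma_subadditive _ _ _ (mu_diag_measure dot_norm E_pvm x) _ _ mG mD DG.
move=> /le_trans; apply.
rewrite -nneseriesZl; last by move=> k _; exact: wlength_ge0.
by apply: lee_nneseries => [k _ _|k _]; [exact: measure_ge0|have [] := GP k].
Qed.

End ResolventToMeasure.

(** * From measure bounds to synthesis bounds *)

Lemma measurable_arc_preimage (R : realType) (D : set (borelC R)) :
  measurable D ->
  measurable ([set t : R | 0 <= t < 1 /\ D (cis t)] : set (measurableTypeR R)).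
Proof.
move=> mD; rewrite [X in measurable X](_ : _ = `[0, 1[ `&` cis @^-1` D).
  by apply: measurableI; [exact: measurable_itv|exact: measurable_cis_preimage].
by apply/seteqP; split=> t; rewrite /= in_itv.
Qed.

Lemma arc_length_le (R : realType) (D : set (borelC R)) (a b : R) :
  measurable D -> a <= b ->
  (forall t, 0 <= t < 1 -> D (cis t) -> a <= t <= b) ->
  (arc_length D <= (b - a)%:E)%E.
Proof.
move=> mD ab Dab; rewrite /arc_length.
have -> : ((b - a)%:E = @lebesgue_measure R `[a, b])%E.
  rewrite lebesgue_measure_itv/= lte_fin lt_neqAle ab andbT EFinB.
  by case: eqVneq => [->|//]; rewrite subee.
apply: le_measure; rewrite ?inE; [exact: measurable_arc_preimage|exact: measurable_itv|].
by move=> t [t01 Dt]; rewrite /= in_itv/=; exact: Dab.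
Qed.

Section MeasureToSynthesis.
Context {R : realType} {H : completeNormedModType R[i]}.
Context {dot : {dot H for Num.conj}}.
Hypothesis dot_norm : forall u : H, dot u u = `|u| ^+ 2.
Context {A : {linear H -> H}}.
Hypothesis A_unitary : unitary dot A.
Context {E : set (borelC R) -> {linear H -> H}}.
Hypothesis E_spectral : spectral_measure_of dot A E.

Let E_pvm : projection_valued_measure dot E := E_spectral.1.
Let A_iso := unitary_iso dot_norm A_unitary.

Lemma pvm_iter D k u : measurable D -> E D (iter k A u) = iter k A (E D u).
Proof.
move=> mD; elim: k => //= k ih.
by rewrite (pvm_comm dot_norm E_spectral)// ih.
Qed.

Lemma iter_near k v (w : R[i]) (e : R) : rnorm w = 1 ->
  rnorm (A v - w *: v) <= e * rnorm v ->
  rnorm (iter k A v - w ^+ k *: v) <= k%:R * (e * rnorm v).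
Proof.
move=> w1 Av; rewrite iter_sub_telescope (le_trans (rnorm_sum _ _ _))//.
rewrite (le_trans (ler_sum _ (G := fun=> e * rnorm v) _))//.
  by move=> i _; rewrite rnormZ rnormX w1 expr1n mul1r rnorm_iter.
by rewrite sumr_const card_ord mulr_natl.
Qed.

(* [arc_prefix N 0] is empty rather than the point [1], so that the pieces cover
   the whole circle. *)
Definition arc_prefix (N j : nat) : set (borelC R) :=
  if j is 0%N then set0 else cis_arc 0 (j%:R / N%:R).

Definition arc_piece N j : set (borelC R) := arc_prefix N j.+1 `\` arc_prefix N j.

Lemma measurable_arc_prefix N j : measurable (arc_prefix N j).
Proof. by case: j => [|j]; [exact: measurable0|exact: measurable_cis_arc]. Qed.

Lemma measurable_arc_piece N j : measurable (arc_piece N j).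
Proof. by apply: measurableD; exact: measurable_arc_prefix. Qed.

Lemma arc_prefix_sub N i j : (i <= j)%N -> arc_prefix N i `<=` arc_prefix N j.
Proof.
case: i => [|i]; first by move=> _ z.
case: j => // j ij z [t /=]; rewrite in_itv/= => /andP[t0 ti] <-.
exists t => //=; rewrite in_itv/= t0 (le_trans ti)//.
by rewrite ler_wpM2r ?invr_ge0// ler_nat.
Qed.

Lemma arc_pieceP N j z : arc_piece N j z ->
  exists2 t, j%:R / N%:R <= t <= j.+1%:R / N%:R & z = cis t.
Proof.
move=> [[t /=]]; rewrite in_itv/= => /andP[t0 tj] <- Gj; exists t => //.
rewrite tj andbT; case: j Gj tj => [|j] Gj tj; first by rewrite mul0r.
rewrite leNgt; apply/negP => jt; apply: Gj; exists t => //=.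
by rewrite in_itv/= t0 ltW.
Qed.

Lemma arc_piece_sub_circle N j : arc_piece N j `<=` @unit_circle R.
Proof. by move=> z /arc_pieceP[t _ ->]; exact: rnorm_cis. Qed.

Lemma arc_length_piece N j : (j < N)%N -> (arc_length (arc_piece N j) <= (N%:R^-1)%:E)%E.
Proof.
move=> jN; have N0 : 0 < N%:R :> R by rewrite ltr0n (leq_trans _ jN).
have -> : N%:R^-1 = j.+1%:R / N%:R - j%:R / N%:R :> R.
  by rewrite -mulrBl -natrB// subSnn mul1r.
apply: arc_length_le; first exact: measurable_arc_piece.
  by rewrite ler_wpM2r ?invr_ge0 ?(ltW N0)// ler_nat.
move=> t /andP[t0 t1] [[t' /=]]; rewrite in_itv/= => /andP[t'0 t'j] tt' Gj.
apply/andP; split.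
  case: j Gj {jN t'j} => [|j] Gj; first by rewrite mul0r.
  rewrite leNgt; apply/negP => jt; apply: Gj; exists t => //=.
  by rewrite in_itv/= t0 ltW.
rewrite leNgt; apply/negP => jt.
(* [t'] may a priori equal 1; here [t' < t < 1] brings both into the range where [cis] is
   injective. *)
have t't : t' < t by exact: le_lt_trans jt.
have : t' = t by apply: cis_inj => //; rewrite ?t0 ?t'0// (lt_trans t't).
by move: t't => /[swap] ->; rewrite ltxx.
Qed.

Lemma pvm_arc_prefix N j u :
  E (arc_prefix N j) u = \sum_(i < j) E (arc_piece N i) u.
Proof.
elim: j => [|j ih]; first by rewrite big_ord0 (pvm_set0 E_pvm).
have dis : arc_prefix N j `&` arc_piece N j = set0.
  by rewrite /arc_piece setDE setICA setICr setI0.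
rewrite big_ord_recr/= -ih -(pvmU E_pvm _ (measurable_arc_prefix N j) _ dis).
  by rewrite /arc_piece setDUK//; exact: arc_prefix_sub.
exact: measurable_arc_piece.
Qed.

Lemma pvm_arc_sum N u : (0 < N)%N -> u = \sum_(i < N) E (arc_piece N i) u.
Proof.
move=> N0; rewrite -pvm_arc_prefix -{1}(pvm_unit_circle dot_norm A_unitary E_spectral u).
case: N N0 => // N _; rewrite /arc_prefix divff ?pnatr_eq0// unit_circleE//.
Qed.

Lemma dot_arc_piece N i j u v : (i < j)%N ->
  dot (E (arc_piece N i) u) (E (arc_piece N j) v) = 0.
Proof.
move=> ij; apply: (pvm_orth E_pvm); [exact: measurable_arc_piece..|].
apply/seteqP; split=> // z [[zi _] [_ zj]]; apply: zj.
exact: (arc_prefix_sub ij).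
Qed.

(** The vector identity applied to [c k *: x], with the nonzero factor [|x|^2] cancelled. *)
Lemma scalar_dft N (c : nat -> R[i]) (x : H) : (0 < N)%N -> rnorm x != 0 ->
  \sum_(j < N) rnorm (\sum_(k < N) c k * cis (j%:R / N%:R) ^+ k) ^+ 2
  = N%:R * \sum_(k < N) rnorm (c k) ^+ 2.
Proof.
move=> N0 x0; apply: (@mulIf _ (rnorm x ^+ 2)); first by rewrite expf_neq0.
have := dft_parseval dot_norm 0 (fun k => c k *: x) N0.
under [in X in X = _ -> _]eq_bigr => j _.
  under [in X in rnorm X]eq_bigr => k _ do rewrite add0r cis_muln scalerA mulrC.
  rewrite -scaler_suml rnormZ exprMn; over.
under [in X in _ = X -> _]eq_bigr => k _ do rewrite rnormZ exprMn.
by rewrite -!mulr_suml mulrA.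
Qed.

Variables (x : H) (C : R).
Hypothesis C_gt0 : 0 < C.
Hypothesis xC : forall D : set (borelC R), measurable D -> D `<=` @unit_circle R ->
  (mu_diag E x D <= C%:E * arc_length D)%E.

Lemma rnorm_arc_piece N j : (j < N)%N -> rnorm (E (arc_piece N j) x) ^+ 2 <= C / N%:R.
Proof.
move=> jN; rewrite -lee_fin.
apply: le_trans (xC (measurable_arc_piece N j) (@arc_piece_sub_circle N j)) _.
by rewrite EFinM lee_wpmul2l ?lee_fin ?(ltW C_gt0)// arc_length_piece.
Qed.

Lemma synthesis_of_measure : synthesis_bound (fun k : nat => iter k A x) C.
Proof.
apply: synthesis_bound_nat => n c.
have [x0|x0] := eqVneq (rnorm x) 0.
  rewrite (rnorm_eq0 x0) big1 => [|k _].
    rewrite rnorm0 expr0n mulr_ge0 ?(ltW C_gt0)//; apply: sumr_ge0 => *; exact: sqr_ge0.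
  by apply/rnorm_eq0; rewrite rnormZ rnorm_iter// rnorm0 mulr0.
set S := \sum_(k < n) rnorm (c k) ^+ 2.
have S0 : 0 <= S by apply: sumr_ge0 => *; exact: sqr_ge0.
have CS0 : 0 <= C * S by rewrite mulr_ge0// ltW.
rewrite -(@sqr_sqrtr _ (C * S))// ler_pXn2r ?nnegrE ?rnorm_ge0 ?sqrtr_ge0//.
(* If [A v] is within [e |v|] of [w v], then [p(A) v] is within [M e |v|] of [p(w) v], by
   [iter_near]. *)
pose M := \sum_(k < n) rnorm (c k) * k%:R.
have M0 : 0 <= M by apply: sumr_ge0 => *; rewrite mulr_ge0// rnorm_ge0.
apply/ler_addgt0Pl => e' e'0.
have [e e0 eM] : exists2 e : R, 0 < e & M * e * rnorm x <= e'.
  have MX : 0 < M * rnorm x + 1 by rewrite ltr_wpDl// mulr_ge0// rnorm_ge0.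
  exists (e' / (M * rnorm x + 1)); first by rewrite divr_gt0.
  rewrite mulrAC mulrA ler_pdivrMr// [leRHS]mulrC ler_wpM2r ?(ltW e'0)//.
  by rewrite lerDl.
have [d d0 cisd] := cis_unif e0.
have [m md] : exists m : nat, m.+1%:R^-1 < d.
  have := near_infty_natSinv_lt (PosNum d0) => -[m _ /(_ m (leqnn _))] /= h.
  by exists m.
(* [N > n] leaves room for all coefficients in the transform, and [N > m] makes the mesh [1 / N]
   finer than [d]. *)
pose N := (n + m).+1; have N0 : (0 < N)%N by [].
have N0R : 0 < N%:R :> R by rewrite ltr0n.
have Nd : N%:R^-1 < d.
  by rewrite (le_lt_trans _ md)// lef_pV2 ?posrE ?ltr0n// ler_nat ltnS leq_addl.
pose v j := E (arc_piece N j) x; pose w j : R[i] := cis (j%:R / N%:R).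
have Av j : rnorm (A (v j) - w j *: v j) <= e * rnorm (v j).
  rewrite -(@ler_pXn2r _ 2) ?nnegrE ?mulr_ge0 ?rnorm_ge0 ?(ltW e0)// exprMn.
  apply: (pvm_upper dot_norm A_unitary E_spectral (measurable_arc_piece N j)
    (@arc_piece_sub_circle N j)).
    by rewrite /v (pvm_idem E_pvm)//; exact: measurable_arc_piece.
  move=> z /arc_pieceP[t /andP[jt tj] ->].
  rewrite ler_pXn2r ?nnegrE ?rnorm_ge0 ?(ltW e0)// ltW// cisd//.
  rewrite ger0_norm ?subr_ge0// (le_lt_trans _ Nd)// lerBlDl (le_trans tj)//.
  by rewrite -natr1 mulrDl mul1r.
pose f j := \sum_(k < n) c k *: (iter k A (v j) - w j ^+ k *: v j).
pose g j := (\sum_(k < n) c k * w j ^+ k) *: v j.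
have xE : \sum_(k < n) c k *: iter k A x = \sum_(j < N) f j + \sum_(j < N) g j.
  rewrite -big_split/= {1}(pvm_arc_sum x N0).
  under eq_bigr => k _ do rewrite iter_sum scaler_sumr.
  rewrite exchange_big/=; apply: eq_bigr => j _.
  rewrite /f /g scaler_suml -big_split/=; apply: eq_bigr => k _.
  by rewrite scalerBr scalerA subrK.
have fN : rnorm (\sum_(j < N) f j) <= M * e * rnorm x.
  have mP := measurable_arc_piece N.
  (* The errors stay in the orthogonal ranges of the pieces, so their squares add up and the total
     error does not grow with [N]. *)
  have fP j : f j = E (arc_piece N j) (f j).
    rewrite /f linear_sum; apply: eq_bigr => k _.
    rewrite [RHS]linearZ/=; congr (_ *: _).
    by rewrite [RHS]linearB/= [E _ (_ *: _)]linearZ/= pvm_iter// /v (pvm_idem E_pvm).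
  rewrite -(@ler_pXn2r _ 2) ?nnegrE ?rnorm_ge0 ?mulr_ge0 ?rnorm_ge0 ?(ltW e0)//.
  rewrite (sqr_rnorm_sum_orth dot_norm); last first.
    by move=> i j /andP[ij _]; rewrite fP (fP j) dot_arc_piece.
  rewrite exprMn (pvm_arc_sum x N0) (sqr_rnorm_sum_orth dot_norm (F := v)); last first.
    by move=> i j /andP[ij _]; rewrite dot_arc_piece.
  rewrite mulr_sumr; apply: ler_sum => j _.
  rewrite -exprMn ler_pXn2r ?nnegrE ?rnorm_ge0 ?mulr_ge0 ?rnorm_ge0 ?(ltW e0)//.
  rewrite (le_trans (rnorm_sum _ _ _))// -mulrA mulr_suml.
  apply: ler_sum => k _; rewrite rnormZ -mulrA ler_wpM2l ?rnorm_ge0//.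
  by apply: iter_near => //; exact: rnorm_cis.
have gN : rnorm (\sum_(j < N) g j) <= Num.sqrt (C * S).
  rewrite -(@ler_pXn2r _ 2) ?nnegrE ?rnorm_ge0 ?sqrtr_ge0// sqr_sqrtr//.
  rewrite (sqr_rnorm_sum_orth dot_norm); last first.
    by move=> i j /andP[ij _]; rewrite /g dotZl dotZr dot_arc_piece// !mulr0.
  pose c' k := if (k < n)%N then c k else 0.
  have trunc (V : zmodType) (G : nat -> V) (G' : nat -> V) :
      (forall k, (k < n)%N -> G' k = G k) -> (forall k, (n <= k)%N -> G' k = 0) ->
      \sum_(k < N) G' k = \sum_(k < n) G k.
    move=> GG G0; rewrite -(big_mkord xpredT G') -(big_mkord xpredT G).
    rewrite (@big_cat_nat _ _ _ n)//=; last by rewrite /N ltnW// ltnS leq_addr.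
    rewrite [X in _ + X]big_nat_cond [X in _ + X]big1 ?addr0; last first.
      by move=> k /andP[/andP[nk _] _]; exact: G0.
    rewrite big_nat_cond [RHS]big_nat_cond.
    by apply: eq_bigr => k /andP[/andP[_ kn] _]; exact: GG.
  have := scalar_dft c' N0 x0.
  rewrite (trunc _ (fun k => rnorm (c k) ^+ 2) (fun k => rnorm (c' k) ^+ 2)); last 2 first.
  - by move=> k kn; rewrite /c' kn.
  - by move=> k kn; rewrite /c' ltnNge kn rnorm0 expr0n.
  rewrite -/S => dft.
  apply: (@le_trans _ _ (\sum_(j < N) rnorm (\sum_(k < N) c' k * w j ^+ k) ^+ 2 * (C / N%:R))).
    apply: ler_sum => j _; rewrite /g rnormZ exprMn.
    rewrite (trunc _ (fun k => c k * w j ^+ k) (fun k => c' k * w j ^+ k)).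
    - by rewrite ler_wpM2l ?sqr_ge0// rnorm_arc_piece.
    - by move=> k kn; rewrite /c' kn.
    - by move=> k kn; rewrite /c' ltnNge kn mul0r.
  rewrite -mulr_suml dft le_eqVlt; apply/orP; left; apply/eqP.
  by field; rewrite gt_eqF.
rewrite xE (le_trans (rnormD _ _))// lerD//.
exact: le_trans fN eM.
Qed.

End MeasureToSynthesis.

(** * Total variation *)

Lemma sum_measure_le d (T : measurableType d) (R : realType)
    (m : {measure set T -> \bar R}) (F : nat -> set T) n :
  (forall i, measurable (F i)) -> trivIset setT F ->
  (\sum_(i < n) m (F i) <= m (\bigcup_i F i))%E.
Proof.
move=> mF tF; rewrite -(big_mkord xpredT (fun i => m (F i))) measure_bigcup//.
have -> : (\sum_(i <oo | i \in setT) m (F i) = \sum_(i <oo) m (F i))%E.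
  by apply: eq_eseriesl => i; rewrite in_setT.
exact: nneseries_lim_ge.
Qed.

Section Variation.
Context {R : realType} {H : completeNormedModType R[i]}.
Context {dot : {dot H for Num.conj}}.
Hypothesis dot_norm : forall u : H, dot u u = `|u| ^+ 2.
Context {E : set (borelC R) -> {linear H -> H}}.
Hypothesis E_pvm : projection_valued_measure dot E.
Implicit Types D : set (borelC R).

Lemma arc_length_fin D : measurable D -> arc_length D = (fine (arc_length D))%:E.
Proof.
move=> mD; rewrite fineK// fin_real//; apply/andP; split.
  by rewrite (lt_le_trans _ (measure_ge0 _ _)).
apply: (@le_lt_trans _ _ (1 - 0)%:E); last by rewrite ltry.
by apply: arc_length_le => // t /andP[-> /ltW ->].
Qed.

Lemma arc_length_ge0 D : 0 <= fine (arc_length D).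
Proof. by rewrite fine_ge0// measure_ge0. Qed.

Lemma sum_arc_length_le (F : nat -> set (borelC R)) n :
  (forall i, measurable (F i)) -> trivIset setT F ->
  \sum_(i < n) fine (arc_length (F i)) <= fine (arc_length (\bigcup_i F i)).
Proof.
move=> mF tF; rewrite -lee_fin -sumEFin -arc_length_fin; last exact: bigcup_measurable.
under eq_bigr => i _ do rewrite -arc_length_fin//.
pose G i : set (measurableTypeR R) := [set t : R | 0 <= t < 1 /\ F i (cis t)].
rewrite [leRHS](_ : _ = lebesgue_measure (\bigcup_i G i)).
  apply: (@sum_measure_le _ _ _ (@lebesgue_measure R) G).
    by move=> i; exact: measurable_arc_preimage.
  apply/trivIsetP => i j _ _ ij; apply/seteqP; split=> // t [[_ ti] [_ tj]].
  move/trivIsetP : tF => /(_ i j I I ij)/seteqP[/(_ (cis t)) h _]; exact: h.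
congr lebesgue_measure; apply/seteqP; split=> t.
  by move=> [t01 [i _ Fi]]; exists i.
by move=> [i _ [t01 Fi]]; split=> //; exists i.
Qed.

Lemma rnorm_mu_offdiag_le D x y : measurable D ->
  rnorm (mu_offdiag dot E x y D) <= rnorm (E D x) * rnorm (E D y).
Proof.
move=> mD; apply: le_trans (CauchySchwarz_dot dot_norm _ _).
by rewrite -(pvm_selfadj E_pvm)// (pvm_idem E_pvm).
Qed.

(** On each partition [|mu_xy(F i)| <= |E (F i) x| |E (F i) y|]. Cauchy-Schwarz separates the
    factors; additivity of arc length and of [mu_diag E y] sums them. *)
Lemma variation_of_measure x (C : R) : 0 < C ->
  (forall D, measurable D -> D `<=` @unit_circle R ->
    (mu_diag E x D <= C%:E * arc_length D)%E) ->
  forall (y : H) D, measurable D -> D `<=` @unit_circle R ->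
    (complex_variation (mu_offdiag dot E x y) D <=
       (Num.sqrt C)%:E * sqrte (mu_diag E y D * arc_length D))%E.
Proof.
move=> C0 xC y D mD DT; apply: ge_ereal_sup => _ [F [mF tF FD] <-].
rewrite (arc_length_fin mD) /mu_diag -EFinM /= -sqrtrM ?(ltW C0)//.
apply: lime_le; first by apply: is_cvg_nneseries => n _ _; rewrite lee_fin rnorm_ge0.
apply: nearW => n; rewrite sumEFin lee_fin big_mkord.
set L := fine (arc_length D); have L0 : 0 <= L := arc_length_ge0 D.
have K0 : 0 <= C * (rnorm (E D y) ^+ 2 * L) by rewrite mulr_ge0 ?(ltW C0)// mulr_ge0// sqr_ge0.
rewrite -(@ler_pXn2r _ 2) ?nnegrE ?sqrtr_ge0//; last first.
  by apply: sumr_ge0 => *; exact: rnorm_ge0.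
rewrite sqr_sqrtr//.
apply: (@le_trans _ _ ((\sum_(i < n) rnorm (E (F i) x) * rnorm (E (F i) y)) ^+ 2)).
  rewrite ler_pXn2r ?nnegrE ?sumr_ge0//; last 2 first.
  - by move=> *; exact: rnorm_ge0.
  - by move=> *; rewrite mulr_ge0// rnorm_ge0.
  by apply: ler_sum => i _; exact: rnorm_mu_offdiag_le.
apply: le_trans (CauchySchwarz_sum _ _ _) _.
have sy : \sum_(i < n) rnorm (E (F i) y) ^+ 2 <= rnorm (E D y) ^+ 2.
  rewrite -lee_fin -sumEFin -FD.
  exact: (@sum_measure_le _ _ _ (mu_diag_measure dot_norm E_pvm y) F).
have sx : \sum_(i < n) rnorm (E (F i) x) ^+ 2 <= C * L.
  apply: (@le_trans _ _ (\sum_(i < n) C * fine (arc_length (F i)))).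
    apply: ler_sum => i _; rewrite -lee_fin [leRHS]EFinM -arc_length_fin//.
    by apply: xC => //; apply: subset_trans DT; rewrite -FD; exact: bigcup_sup.
  rewrite -mulr_sumr ler_wpM2l ?(ltW C0)// /L -FD; exact: sum_arc_length_le.
have -> : C * (rnorm (E D y) ^+ 2 * L) = (C * L) * rnorm (E D y) ^+ 2 by ring.
by apply: ler_pM => //; apply: sumr_ge0 => *; exact: sqr_ge0.
Qed.

Lemma measure_of_variation x (C : R) : 0 < C ->
  (forall (y : H) D, measurable D -> D `<=` @unit_circle R ->
    (complex_variation (mu_offdiag dot E x y) D <=
       (Num.sqrt C)%:E * sqrte (mu_diag E y D * arc_length D))%E) ->
  forall D, measurable D -> D `<=` @unit_circle R ->
    (mu_diag E x D <= C%:E * arc_length D)%E.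
Proof.
move=> C0 xC D mD DT; have := xC x D mD DT.
rewrite (arc_length_fin mD) /mu_diag -!EFinM /= lee_fin -sqrtrM ?(ltW C0)//.
set L := fine (arc_length D); have L0 : 0 <= L := arc_length_ge0 D.
set m := rnorm (E D x) ^+ 2; have m0 : 0 <= m by rewrite sqr_ge0.
move=> varC; have mK : m <= Num.sqrt (C * (m * L)).
  rewrite -lee_fin; apply: le_trans varC.
  (* The trivial partition of [D] gives [m <= sqrt (C m L)]; squaring and cancelling [m]
     concludes. *)
  pose F := bigcup2 D set0.
  have mF i : measurable (F i) by case: i => [|[|i]] //; exact: measurable0.
  have tF : trivIset setT F by rewrite /F -trivIset_bigcup2 setI0.
  apply: le_trans (ereal_sup_ubound _); last first.
    by exists F => //; split => //; rewrite bigcup2E setU0.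
  apply: le_trans (nneseries_lim_ge 1%N _); last first.
    by move=> n _ _; rewrite lee_fin rnorm_ge0.
  rewrite big_nat1 lee_fin /m (sqr_rnorm_pvm dot_norm E_pvm)//.
  exact: Re_le_rnorm.
have [->|mn0] := eqVneq m 0; first by rewrite mulr_ge0// ltW.
have mgt0 : 0 < m by rewrite lt_def mn0.
rewrite -(ler_pM2l mgt0) -expr2.
have K0 : 0 <= C * (m * L) by rewrite mulr_ge0 ?(ltW C0)// mulr_ge0.
have -> : m * (C * L) = C * (m * L) by ring.
by rewrite -(sqr_sqrtr K0) ler_pXn2r ?nnegrE ?sqrtr_ge0.
Qed.

End Variation.

(** * The cycle of implications between the five conditions *)

Theorem theorem3p2 (R : realType) (H : completeNormedModType R[i])
  (dot : {dot H for Num.conj})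
  (dot_norm : forall u : H, dot u u = `|u| ^+ 2)
  (A : {linear H -> H}) (A_unitary : unitary dot A)
  (E : set (borelC R) -> {linear H -> H})
  (E_spectral : spectral_measure_of dot A E)
  (x : H) (C : R) (C_gt0 : 0 < C) :
  [<->
    bessel dot (fun k : nat => iter k A x) C;
    bessel dot (fun k : int => op_powz A k x) C;
    forall D : set (borelC R), measurable D -> D `<=` @unit_circle R ->
      (mu_diag E x D <= C%:E * arc_length D)%E;
    forall (y : H) (D : set (borelC R)),
      measurable D -> D `<=` @unit_circle R ->
      (complex_variation (mu_offdiag dot E x y) D
         <= (Num.sqrt C)%:E * sqrte (mu_diag E y D * arc_length D))%E;
    forall l : R[i], rnorm l <> 1 ->
      rnorm (resolvent A l x) ^+ 2 <= C * `|1 - rnorm l ^+ 2|^-1].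
Proof.
have E_pvm := E_spectral.1.
have i_syn := bessel_synthesis dot_norm (f := fun k : nat => iter k A x) (C := C).
have syn_iii (xC : synthesis_bound (fun k : nat => iter k A x) C) :
    forall D : set (borelC R), measurable D -> D `<=` @unit_circle R ->
      (mu_diag E x D <= C%:E * arc_length D)%E.
  apply: (borel_bound dot_norm A_unitary E_spectral C_gt0) => l l1.
  exact: (resolvent_bound dot_norm A_unitary (ltW C_gt0)).
have iii_syn := synthesis_of_measure dot_norm A_unitary E_spectral C_gt0.
tfae.
- move=> /i_syn xC; apply: (synthesis_bessel dot_norm C_gt0).
  exact: (synthesis_int dot_norm A_unitary).
- move=> /(bessel_synthesis dot_norm) xC; apply: syn_iii.
  apply: synthesis_bound_nat => n c.
  (* The two-sided bound is restricted to nonnegative indices. *)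
  have := xC (map Posz (iota 0 n)) (fun k => c (absz k)).
  rewrite map_inj_uniq ?iota_uniq; last by move=> ? ? [].
  rewrite !big_map => /(_ isT) /=.
  rewrite -(big_mkord xpredT (fun k => rnorm (c k) ^+ 2)).
  by rewrite -(big_mkord xpredT (fun k => c k *: iter k A x)) /index_iota subn0.
- exact: (variation_of_measure dot_norm E_pvm C_gt0).
- move=> /(measure_of_variation dot_norm E_pvm C_gt0)/iii_syn xC l l1.
  exact: (resolvent_bound dot_norm A_unitary (ltW C_gt0)).
- move=> resC; apply: (synthesis_bessel dot_norm C_gt0); apply: iii_syn.
  exact: (borel_bound dot_norm A_unitary E_spectral C_gt0 resC).
Qed.
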